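(* Let $(A(n))_{n\ge1}$ be an i.i.d. sequence of random $(\max,+)$ operators on $\mathbb R^d$ with the memory loss property, such that $\max_{i,j}A(1)_{ij}$ and $\min_j\max_iA(1)_{ij}$ have finite second moments, and assume the Lyapunov exponent is $\gamma=0$. Let $\sigma^2\ge0$ be the constant such that for every $\mathbb R^d$-valued $X^0$ independent of $(A(n))$, $x(n,X^0)/\sqrt n$ converges weakly to a random vector with all coordinates equal of law $\mathcal N(0,\sigma^2)$. Then $\sigma^2=0$ if and only if $\{\rho_{\max}(B): B\in T_A\}=\{0\}$.
   Context: $\mathbb R_{\max}=\mathbb R\cup\{-\infty\}$. A $d\times d$ matrix $A$ with entries in $\mathbb R_{\max}$ and no row identically $-\infty$ defines a $(\max,+)$ operator on $\mathbb R^d$ by $(Ax)_i=\max_j(A_{ij}+x_j)$; composition corresponds to the $(\max,+)$ product $(AB)_{ij}=\max_p(A_{ip}+B_{pj})$. Let $\bar x$ be the class of $x$ modulo $\mathbb R\mathbf 1$, $\mathbf 1=(1,\dots,1)'$. An operator $A$ has rank 1 if $\overline{Ax}$ does not depend on $x$; the sequence has the memory loss property if some $A(N)\cdots A(1)$ has rank 1 with positive probability. $x(0,X^0)=X^0$, $x(n,X^0)=A(n)x(n-1,X^0)$; $\gamma$ is the Lyapunov exponent ($x(n,X^0)/n\to\gamma\mathbf 1$ a.s.). $S_A$ is the support of the law of $A(1)$ and $T_A$ the semigroup generated by $S_A$ under $(\max,+)$ product. The graph $\mathcal G(A)$ of $A$ has nodes $1,\dots,d$ and an arc $(i,j)$ with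 weight $A_{ij}$ whenever $A_{ij}>-\infty$. For an elementary circuit $c=(i_1,\dots,i_n,i_1)$ its average weight is $\frac1n\sum_{j=1}^nA_{i_ji_{j+1}}$ ($i_{n+1}=i_1$), and $\rho_{\max}(A)$ is the maximum of average weights over elementary circuits of $\mathcal G(A)$. *)

(* Defs.v *)
From HB Require Import structures.
From mathcomp Require Import all_boot all_order all_algebra.
From mathcomp Require Import all_classical all_reals all_analysis.
From mathcomp Require Import measurable_realfun.
Set Implicit Arguments. Unset Strict Implicit. Unset Printing Implicit Defensive.
Import Order.TTheory GRing.Theory Num.Theory.
Import numFieldNormedType.Exports.
Local Open Scope classical_set_scope.
Local Open Scope ring_scope.

(* (max,+) matrices: entries in R_max = R u {-oo}, represented inside \bar R.   *)
Definition is_maxplus_op (R : realType) (d : nat) (M : 'M[\bar R]_d) : Prop :=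
  (forall i j, M i j != +oo%E) /\ (forall i, exists j, M i j != -oo%E).

Definition mp_mul (R : realType) (d : nat) (A B : 'M[\bar R]_d) : 'M[\bar R]_d :=
  \matrix_(i, j) (\big[maxe/-oo%E]_p (A i p + B p j)%E).

Definition mp_id (R : realType) (d : nat) : 'M[\bar R]_d :=
  \matrix_(i, j) (if i == j then 0%E else -oo%E).

Definition mp_apply (R : realType) (d : nat) (M : 'M[\bar R]_d) (x : 'rV[R]_d)
  : 'rV[R]_d :=
  \row_i fine (\big[maxe/-oo%E]_j (M i j + (x 0 j)%:E)%E).

(* rank 1: the class of Ax modulo R1 does not depend on x. *)
Definition mp_rank1 (R : realType) (d : nat) (M : 'M[\bar R]_d) : Prop :=
  forall x y : 'rV[R]_d, exists c : R,
    forall i, mp_apply M x 0 i - mp_apply M y 0 i = c.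

Fixpoint mp_prod (R : realType) (d : nat) (T : Type)
  (A : nat -> T -> 'M[\bar R]_d) (n : nat) (w : T) : 'M[\bar R]_d :=
  match n with
  | 0 => mp_id R d
  | m.+1 => mp_mul (A m.+1 w) (mp_prod A m w)
  end.

Fixpoint mp_orbit (R : realType) (d : nat) (T : Type)
  (A : nat -> T -> 'M[\bar R]_d) (X0 : T -> 'rV[R]_d) (n : nat) (w : T)
  : 'rV[R]_d :=
  match n with
  | 0 => X0 w
  | m.+1 => mp_apply (A m.+1 w) (mp_orbit A X0 m w)
  end.

Definition mx_event (R : realType) (d : nat) (T : Type)
  (M : T -> 'M[\bar R]_d) (B : 'I_d -> 'I_d -> set (\bar R)) : set T :=
  [set w | forall i j, B i j (M w i j)].

Definition rv_event (R : realType) (d : nat) (T : Type)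
  (X : T -> 'rV[R]_d) (C : 'I_d -> set R) : set T :=
  [set w | forall k, C k (X w 0 k)].

(* (A(n))_{n>=1} is an i.i.d. sequence of random (max,+) operators:           *)
(* every realization is a (max,+) operator, entries are measurable, the laws   *)
(* of the A(n) coincide (on measurable rectangles, which determine the law),   *)
(* and the A(n) are mutually independent (product rule for every finite family *)
(* of distinct indices and measurable rectangles; rectangles form a pi-system   *)
(* generating sigma(A(n))).                                                     *)
Definition iid_maxplus (R : realType) (d : nat) (d0 : measure_display)
  (T : measurableType d0) (P : probability T R)
  (A : nat -> T -> 'M[\bar R]_d) : Prop :=
  [/\ (forall n w, (0 < n)%N -> is_maxplus_op (A n w)),
      (forall n i j, (0 < n)%N -> measurable_fun setT (fun w => A n w i j)),
      (forall n (B : 'I_d -> 'I_d -> set (\bar R)), (0 < n)%N ->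
         (forall i j, measurable (B i j)) ->
         P (mx_event (A n) B) = P (mx_event (A 1%N) B)) &
      (forall (s : seq nat) (B : nat -> 'I_d -> 'I_d -> set (\bar R)),
         uniq s -> all (fun n => 0 < n)%N s ->
         (forall n i j, measurable (B n i j)) ->
         fine (P (\bigcap_(n in [set` s]) mx_event (A n) (B n))) =
         \prod_(n <- s) fine (P (mx_event (A n) (B n))))].

Definition indep_init (R : realType) (d : nat) (d0 : measure_display)
  (T : measurableType d0) (P : probability T R)
  (A : nat -> T -> 'M[\bar R]_d) (X0 : T -> 'rV[R]_d) : Prop :=
  (forall k, measurable_fun setT (fun w => X0 w 0 k)) /\
  (forall (C : 'I_d -> set R) (s : seq nat)
          (B : nat -> 'I_d -> 'I_d -> set (\bar R)),
     (forall k, measurable (C k)) -> all (fun n => 0 < n)%N s ->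
     (forall n i j, measurable (B n i j)) ->
     fine (P (rv_event X0 C `&` \bigcap_(n in [set` s]) mx_event (A n) (B n))) =
     fine (P (rv_event X0 C)) *
     fine (P (\bigcap_(n in [set` s]) mx_event (A n) (B n)))).

Definition memory_loss (R : realType) (d : nat) (d0 : measure_display)
  (T : measurableType d0) (P : probability T R)
  (A : nat -> T -> 'M[\bar R]_d) : Prop :=
  exists N : nat, (0 < N)%N /\ (0 < P [set w | mp_rank1 (mp_prod A N w)])%E.

Definition std_gauss_pdf (R : realType) (g : R) : R :=
  expR (- (g ^+ 2) / 2) / Num.sqrt (2 * pi).

(* E f(Z 1) for Z ~ N(0, s2) (s2 >= 0; for s2 = 0 this is f(0)):              *)
(* Z = sqrt(s2) G with G standard Gaussian.                                   *)
Definition gauss_diag_expect (R : realType) (d : nat) (s2 : R)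
  (f : 'rV[R]_d -> R) : \bar R :=
  (\int[@lebesgue_measure R]_g
     ((f (const_mx (Num.sqrt s2 * g))) * std_gauss_pdf g)%:E)%E.

Definition clt_holds (R : realType) (d : nat) (d0 : measure_display)
  (T : measurableType d0) (P : probability T R)
  (A : nat -> T -> 'M[\bar R]_d) (X0 : T -> 'rV[R]_d) (s2 : R) : Prop :=
  forall f : 'rV[R]_d -> R, continuous f -> (exists M : R, forall x, `|f x| <= M) ->
    (fun n : nat =>
       (\int[P]_w (f ((Num.sqrt (n%:R))^-1 *: mp_orbit A X0 n w))%:E)%E)
      @ \oo --> gauss_diag_expect s2 f.

(* Support S_A of the law of A(1) in the space of (max,+) operators, with the *)
(* topology of R_max (entrywise; -oo has neighbourhoods [-oo, a)).            *)
Definition mp_support (R : realType) (d : nat) (d0 : measure_display)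
  (T : measurableType d0) (P : probability T R)
  (A : nat -> T -> 'M[\bar R]_d) : set 'M[\bar R]_d :=
  [set B | is_maxplus_op B /\
     forall U : 'I_d -> 'I_d -> set (\bar R),
       (forall i j, open (U i j) /\ U i j (B i j)) ->
       (0 < P (mx_event (A 1%N) U))%E].

Inductive mp_semigroup (R : realType) (d : nat) (S : set 'M[\bar R]_d)
  : 'M[\bar R]_d -> Prop :=
  | mp_sg_base B : S B -> mp_semigroup S B
  | mp_sg_mul B C : mp_semigroup S B -> mp_semigroup S C ->
                    mp_semigroup S (mp_mul B C).

(* Elementary circuits of G(B): nonempty duplicate-free node sequences        *)
(* (i_1,...,i_n) with arcs i_k -> i_{k+1} (cyclically), i.e. finite weights.  *)
Definition mp_arcs (d : nat) (c : seq 'I_d) : seq ('I_d * 'I_d) := zip c (rot 1 c).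

Definition elem_circuit (R : realType) (d : nat) (B : 'M[\bar R]_d)
  (c : seq 'I_d) : Prop :=
  [/\ c != [::], uniq c & all (fun p => B p.1 p.2 != -oo%E) (mp_arcs c)].

Definition circuit_avg (R : realType) (d : nat) (B : 'M[\bar R]_d)
  (c : seq 'I_d) : \bar R :=
  ((size c)%:R^-1%:E * \sum_(p <- mp_arcs c) B p.1 p.2)%E.

Definition rho_max (R : realType) (d : nat) (B : 'M[\bar R]_d) : \bar R :=
  ereal_sup [set circuit_avg B c | c in elem_circuit B].

(* Main.v *)
Require Import Defs.
From HB Require Import structures.
From mathcomp Require Import all_boot all_order all_algebra.
From mathcomp Require Import all_classical all_reals all_analysis.
From mathcomp Require Import measurable_realfun.
From mathcomp Require Import ring lra.
Set Implicit Arguments. Unset Strict Implicit. Unset Printing Implicit Defensive.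
Import Order.TTheory GRing.Theory Num.Theory.
Import numFieldNormedType.Exports.
Local Open Scope classical_set_scope.
Local Open Scope ring_scope.

(* If every B in T_A has rho_max B = 0, then A(n)...A(1) has a circuit of average
   weight 0, so some coordinate of x(n,0) is nonnegative almost surely; hence the
   limit law N(0,s2) gives no mass to (-oo,0), and s2 = 0.

   Conversely, assume s2 = 0.  In a block R' C R with R and R' of rank 1,
   replacing C by an independent copy translates the output by a scalar jump J
   which depends neither on the input nor on the coordinate.  As
   cos a + cos (a + s J) = 2 cos (s J / 2) cos (a + s J / 2), each block
   multiplies the bound on |E cos (s x(n))| by E |cos (s J / 2)|, which is at most
   1 - c s^2 for small s as soon as |J| >= 1 has positive probability.  With
   s = n^(-1/2) this prevents E cos (x(n)/sqrt n) from tending to 1.  Hence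
   |J| < 1 almost surely: for each n, the values of max_i x_i(n,0) stay within a
   constant which does not depend on n.  If rho_max B <> 0 for some B in T_A, the
   products close to a power B^k have positive probability and give values of
   order k rho_max B, whereas the Lyapunov exponent 0 gives values o(k): a
   contradiction. *)

(** * (max,+) operators *)

(** The input of a block is the random output of the earlier ones, so the gain at one block can be
    iterated only if the bound on |E cos| is uniform over all starting vectors. This uniformity also
    makes real cosines sufficient: the translation by J/2 left by the midpoint formula is absorbed
    into the starting vector. Rank 1 alone does not tie J to the size of C, because a rank 1 factor
    may have a column equal to -oo and then ignores a coordinate. The moment condition on min_j
    max_i A(1)_ij excludes such columns almost surely; hence, with positive probability, the end
    factors have all their entries in some [-K, K]. The output of R' C R started at 0 is then max_i
    (C0)_i up to 2K, and two values of this maximum more than 4K + 1 apart force |J| >= 1. An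
    element of T_A may have entries -oo, and random entries close to -oo are only bounded above, so
    the approximation by random products is one-sided there. A positive rho_max is detected from
    below, by running around one circuit; a negative one from above, by bounding every walk. *)

Section ExtendedMax.
Variables (R : realType).
Local Open Scope ereal_scope.

Lemma bigmaxe_leP (I : finType) (F : I -> \bar R) (y : \bar R) :
  \big[maxe/-oo]_i F i <= y <-> forall i, F i <= y.
Proof.
split=> [h i|h]; first by apply: le_trans h; exact: (@le_bigmax _ _ _ -oo F i).
by apply: bigmax_le => [|i _]; [exact: leNye|exact: h].
Qed.

Lemma bigmaxe_eq (I : finType) (F : I -> \bar R) (i0 : I) :
  exists i, \big[maxe/-oo]_i F i = F i.
Proof.
have [i _ ->] := @eq_bigmax _ _ I -oo i0 xpredT F isT (fun i _ => leNye (F i)).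
by exists i.
Qed.

Lemma adde_neq_pinfty (a b : \bar R) : a != +oo -> b != +oo ->
  a + b != +oo.
Proof. by case: a => [a||]; case: b => [b||]. Qed.

End ExtendedMax.

Section Operators.
Variables (R : realType) (d : nat).
Implicit Types (M A B C : 'M[\bar R]_d) (x y : 'rV[R]_d).

(** The row has a finite entry and none equal to +oo, so the maximum is finite: [fine] loses nothing
    and the maximum is attained. *)
Lemma mp_applyP M x i : is_maxplus_op M ->
  (forall j, (M i j + (x 0 j)%:E <= (mp_apply M x 0 i)%:E)%E) /\
  exists j, (mp_apply M x 0 i)%:E = (M i j + (x 0 j)%:E)%E.
Proof.
move=> [Mp Mr]; have [j0 hj0] := Mr i.
rewrite mxE.
have [j hj] := bigmaxe_eq (fun j => (M i j + (x 0 j)%:E)%E) j0.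
have ub := (bigmaxe_leP (fun j => (M i j + (x 0 j)%:E)%E) _).1 (lexx _).
have -> : (fine (\big[maxe/-oo%E]_j (M i j + (x 0 j)%:E)%E))%:E
  = \big[maxe/-oo%E]_j (M i j + (x 0 j)%:E)%E.
  apply: fineK; rewrite fin_numE; apply/andP; split.
    have := ub j0; move: hj0 (Mp i j0); case: (M i j0) => // r _ _.
    by case: (\big[maxe/-oo%E]_j _) => // /[!leeNy_eq].
  by rewrite hj; move: (Mp i j); case: (M i j).
by split=> //; exists j.
Qed.

Lemma mp_apply_ge M x i j : is_maxplus_op M ->
  (M i j + (x 0 j)%:E <= (mp_apply M x 0 i)%:E)%E.
Proof. by move=> h; have [+ _] := mp_applyP x i h; apply. Qed.

Lemma mp_apply_ex M x i : is_maxplus_op M ->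
  exists j m, [/\ M i j = m%:E & mp_apply M x 0 i = m + x 0 j].
Proof.
move=> h; have [_ [j hj]] := mp_applyP x i h; exists j.
case: (M i j) hj => [m||] //.
by rewrite -EFinD => -[->]; exists m.
Qed.

Lemma mp_apply_le M x y (c : R) i : is_maxplus_op M ->
  (forall j, x 0 j <= y 0 j + c) -> mp_apply M x 0 i <= mp_apply M y 0 i + c.
Proof.
move=> h xy; have [j [m [hm ->]]] := mp_apply_ex x i h.
have := mp_apply_ge y i j h; rewrite hm -EFinD lee_fin => hy.
have := xy j; lra.
Qed.

Lemma mp_apply_shift M x (c : R) i : is_maxplus_op M ->
  mp_apply M (x + const_mx c) 0 i = mp_apply M x 0 i + c.
Proof.
move=> h; apply/eqP; rewrite eq_le; apply/andP; split.
  by apply: mp_apply_le => // j; rewrite !mxE.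
rewrite -lerBrDr; apply: (le_trans (mp_apply_le (y := x + const_mx c) (c := - c) i h _)) => //.
by move=> j; rewrite !mxE; lra.
Qed.

Lemma mp_mulP A B i j : is_maxplus_op A -> is_maxplus_op B ->
  (forall p, (A i p + B p j <= mp_mul A B i j)%E) /\
  exists p, mp_mul A B i j = (A i p + B p j)%E.
Proof.
move=> hA hB; rewrite mxE; split; first exact/(bigmaxe_leP (fun p => (A i p + B p j)%E)).
exact: (bigmaxe_eq (fun p => (A i p + B p j)%E) i).
Qed.

Lemma mp_mul_leP A B i j (y : \bar R) :
  (mp_mul A B i j <= y)%E <-> forall p, (A i p + B p j <= y)%E.
Proof. by rewrite mxE; exact: (bigmaxe_leP (fun p => (A i p + B p j)%E)). Qed.

Lemma is_maxplus_op_mul A B : is_maxplus_op A -> is_maxplus_op B ->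
  is_maxplus_op (mp_mul A B).
Proof.
move=> hA hB; split=> [i j|i].
  have [_ [p ->]] := mp_mulP i j hA hB.
  by apply: adde_neq_pinfty; [exact: hA.1|exact: hB.1].
have [p hp] := hA.2 i; have [j hj] := hB.2 p; exists j.
have [/(_ p) + _] := mp_mulP i j hA hB.
have := hA.1 i p; have := hB.1 p j; move: hp hj.
case: (A i p) => // a _; case: (B p j) => // b _ _ _.
by case: (mp_mul A B i j).
Qed.

Lemma is_maxplus_op_id : is_maxplus_op (mp_id R d).
Proof.
split=> [i j|i]; first by rewrite mxE; case: ifP.
by exists i; rewrite mxE eqxx.
Qed.

Lemma mp_mulA A B C : mp_mul A (mp_mul B C) = mp_mul (mp_mul A B) C.
Proof.
apply/matrixP => i j; apply/eqP; rewrite eq_le; apply/andP; split.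
  apply/mp_mul_leP => p.
  rewrite [mp_mul B C p j]mxE.
  have [q ->] := bigmaxe_eq (fun q => (B p q + C q j)%E) p.
  rewrite addeA; apply: le_trans ((mp_mul_leP _ _ _ _ _).1 (lexx _) q).
  by apply: leeD2r; exact: ((mp_mul_leP _ _ _ _ _).1 (lexx _) p).
apply/mp_mul_leP => q.
rewrite [mp_mul A B i q]mxE.
have [p ->] := bigmaxe_eq (fun p => (A i p + B p q)%E) q.
rewrite -addeA; apply: le_trans ((mp_mul_leP _ _ _ _ _).1 (lexx _) p).
by apply: leeD2l; exact: ((mp_mul_leP _ _ _ _ _).1 (lexx _) q).
Qed.

Lemma mp_mul1 A : mp_mul (mp_id R d) A = A.
Proof.
apply/matrixP => i j; apply/eqP; rewrite eq_le; apply/andP; split.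
  apply/mp_mul_leP => p; rewrite mxE; case: eqP => [->|_]; first by rewrite add0e.
  by rewrite leNye.
have := (mp_mul_leP (mp_id R d) A i j _).1 (lexx _) i.
by rewrite mxE eqxx add0e.
Qed.

Lemma mp_apply_mul A B x : is_maxplus_op A -> is_maxplus_op B ->
  mp_apply (mp_mul A B) x = mp_apply A (mp_apply B x).
Proof.
move=> hA hB; have hAB := is_maxplus_op_mul hA hB.
apply/rowP => i; apply/eqP; rewrite eq_le; apply/andP; split.
  have [j [m [hm ->]]] := mp_apply_ex x i hAB.
  have [_ [p hp]] := mp_mulP i j hA hB.
  have := mp_apply_ge (mp_apply B x) i p hA.
  have := mp_apply_ge x p j hB.
  move: hp; rewrite hm; case: (A i p) => // a; case: (B p j) => // b.
  by rewrite -!EFinD => -[->]; rewrite !lee_fin; lra.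
have [p [a [ha ->]]] := mp_apply_ex (mp_apply B x) i hA.
have [j [b [hb ->]]] := mp_apply_ex x p hB.
have := mp_apply_ge x i j hAB.
have [/(_ p) + _] := mp_mulP i j hA hB; rewrite ha hb -EFinD.
case: (mp_mul A B i j) => [m||] //; rewrite ?lee_fin; lra.
Qed.

Lemma mp_apply_id x : mp_apply (mp_id R d) x = x.
Proof.
apply/rowP => i; have h := is_maxplus_op_id.
have [j [m []]] := mp_apply_ex x i h; rewrite mxE; case: eqP => // <- [<-] ->.
by rewrite add0r.
Qed.

Lemma mp_rank1_apply M x i k : mp_rank1 M ->
  mp_apply M x 0 i - mp_apply M 0 0 i = mp_apply M x 0 k - mp_apply M 0 0 k.
Proof. by move=> /(_ x 0) [c hc]; rewrite !hc. Qed.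

(* A right rank-one factor forgets [x] up to a constant and a left one forgets
   the direction of its argument, so exchanging the middle factor translates
   the output by a vector which is constant and independent of [x]. *)
Lemma mp_rank1_exchange (R1 R2 C C' : 'M[\bar R]_d) x i k :
  is_maxplus_op R1 -> is_maxplus_op R2 -> is_maxplus_op C -> is_maxplus_op C' ->
  mp_rank1 R1 -> mp_rank1 R2 ->
  mp_apply R2 (mp_apply C' (mp_apply R1 x)) 0 i =
  mp_apply R2 (mp_apply C (mp_apply R1 x)) 0 i +
  (mp_apply R2 (mp_apply C' (mp_apply R1 0)) 0 k -
   mp_apply R2 (mp_apply C (mp_apply R1 0)) 0 k).
Proof.
move=> h1 h2 hC hC' r1 r2.
have [c hc] : exists c, mp_apply R1 x = mp_apply R1 0 + const_mx c.
  have [c hc] := r1 x 0; exists c; apply/rowP => j; rewrite -(hc j) !mxE.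
  by rewrite addrC subrK.
have e D : is_maxplus_op D -> mp_apply R2 (mp_apply D (mp_apply R1 x)) 0 i =
    mp_apply R2 (mp_apply D (mp_apply R1 0)) 0 i + c.
  move=> hD; rewrite hc -mp_apply_shift//; congr (mp_apply _ _ _ _).
  by apply/rowP => j; rewrite mp_apply_shift// !mxE.
rewrite !e//.
have e1 := mp_rank1_apply (mp_apply C (mp_apply R1 0)) i k r2.
have e2 := mp_rank1_apply (mp_apply C' (mp_apply R1 0)) i k r2.
lra.
Qed.

Definition rowmax M i : \bar R := \big[maxe/-oo%E]_j M i j.

Lemma rowmaxE M i : is_maxplus_op M -> rowmax M i = (mp_apply M 0 0 i)%:E.
Proof.
move=> h; have [ub [j hj]] := mp_applyP 0 i h.
apply/eqP; rewrite eq_le; apply/andP; split.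
  by apply/bigmaxe_leP => k; have := ub k; rewrite mxE adde0.
rewrite hj mxE adde0; exact: (@le_bigmax _ _ _ _ (M i) j).
Qed.

(** [mp_rank1] quantifies over all vectors; equations between entries turn it into a measurable
    event. They say that rows [i] and [k] differ by a constant. They are obtained from vectors with
    a large [t] at [j] and 0 elsewhere: a finite entry of column [j] then attains the maximum, while
    a row with -oo there stays bounded, so a column is finite everywhere or -oo everywhere. *)
Lemma mp_rank1P M : is_maxplus_op M -> mp_rank1 M <->
  forall i k j, (M i j + rowmax M k = M k j + rowmax M i)%E.
Proof.
move=> h; split=> [r1|eqM x y]; last first.
  have E z i k : mp_apply M z 0 i <=
      mp_apply M z 0 k + (mp_apply M 0 0 i - mp_apply M 0 0 k).
    have [j [m [hm ->]]] := mp_apply_ex z i h.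
    have := eqM i k j; rewrite !rowmaxE// hm.
    have := mp_apply_ge z k j h.
    case: (M k j) => [m'||] //; rewrite -!EFinD lee_fin => h1 [h2]; lra.
  case: (pselect (exists i : 'I_d, True)) => [[i _]|no]; last first.
    by exists 0 => i; case: no; exists i.
  exists (mp_apply M x 0 i - mp_apply M y 0 i) => k.
  have := E x i k; have := E x k i; have := E y i k; have := E y k i; lra.
move=> i k j; rewrite !rowmaxE//.
pose u (t : R) : 'rV[R]_d := \row_l (if l == j then t else 0).
have key t := mp_rank1_apply (u t) i k r1.
have uj t : u t 0 j = t by rewrite mxE eqxx.
have ub (t : R) l : 0 <= t -> mp_apply M (u t) 0 l <= mp_apply M 0 0 l \/
    exists2 m, M l j = m%:E & mp_apply M (u t) 0 l = m + t.
  move=> t0; have [p [m [hm e]]] := mp_apply_ex (u t) l h.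
  case: (eqVneq p j) => [pj|pj].
    by right; exists m; rewrite -?pj// e pj uj.
  left; rewrite e mxE (negbTE pj).
  by have := mp_apply_ge 0 l p h; rewrite hm mxE -EFinD lee_fin.
have lb t l m : M l j = m%:E -> m + t <= mp_apply M (u t) 0 l.
  by move=> hm; have := mp_apply_ge (u t) l j h; rewrite hm uj -EFinD lee_fin.
have noNy l l' m : M l j = m%:E -> M l' j = -oo%E -> False.
  move=> hl hl'.
  pose t : R := `|mp_apply M 0 0 l - m| + 1.
  have t0 : 0 <= t by rewrite /t; apply: addr_ge0.
  have := mp_rank1_apply (u t) l l' r1.
  have := lb t l m hl.
  have [h2|[m']] := ub t l' t0; last by rewrite hl'.
  have := ler_norm (mp_apply M 0 0 l - m); rewrite /t; lra.
case hi : (M i j) (h.1 i j) => [a||] // _; case hk : (M k j) (h.1 k j) => [b||] // _.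
(* With this [t], [a + t] exceeds the value of row [i] at 0 and [b + t] that of row [k], so both
   maxima are attained in column [j]. *)
- pose t : R := `|mp_apply M 0 0 i - a| + `|mp_apply M 0 0 k - b| + 1.
  have n1 := normr_ge0 (mp_apply M 0 0 i - a).
  have n2 := normr_ge0 (mp_apply M 0 0 k - b).
  have n3 := ler_norm (mp_apply M 0 0 i - a).
  have n4 := ler_norm (mp_apply M 0 0 k - b).
  have t0 : 0 <= t by rewrite /t; lra.
  have e1 := key t.
  have l1 := lb t i a hi; have l2 := lb t k b hk.
  have [h1|[a']] := ub t i t0; first by exfalso; move: l1 h1; rewrite /t; lra.
  rewrite hi => -[<-] e2.
  have [h1|[b']] := ub t k t0; first by exfalso; move: l2 h1; rewrite /t; lra.
  rewrite hk => -[<-] e3.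
  by rewrite -!EFinD; congr EFin; lra.
- by case: (noNy i k a).
- by case: (noNy k i b).
Qed.

(** The bound on all entries, in particular their finiteness, lets a product with such factors at
    both ends be compared with its middle factor. *)
Definition rank1_bounded (K : R) M : Prop :=
  (forall i k j, (M i j + rowmax M k = M k j + rowmax M i)%E) /\
  (forall i j, ((- K)%:E <= M i j)%E /\ (M i j <= K%:E)%E).

Lemma mp_apply_bounded_ge M (K : R) x (y : R) i k : is_maxplus_op M -> rank1_bounded K M ->
  y <= x 0 k -> y - K <= mp_apply M x 0 i.
Proof.
move=> h [_ b] yx; have [b1 _] := b i k.
have := mp_apply_ge x i k h; case: (M i k) b1 => [m||] //.
by rewrite -EFinD !lee_fin; lra.
Qed.

Lemma mp_apply_bounded_le M (K : R) x (y : R) i : is_maxplus_op M -> rank1_bounded K M ->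
  (forall k, x 0 k <= y) -> mp_apply M x 0 i <= y + K.
Proof.
move=> h [_ b] yx; have [j [m [hm ->]]] := mp_apply_ex x i h.
by have [_] := b i j; rewrite hm lee_fin; have := yx j; lra.
Qed.

(** The finite left factor spreads one large coordinate to all of them, whereas an upper bound needs
    every coordinate to be small. This is why the events used later combine [exists] for high values
    with [forall] for low ones. *)
Lemma mp_sandwich_ge (R1 R2 C : 'M[\bar R]_d) (K y : R) i k :
  is_maxplus_op R1 -> is_maxplus_op R2 -> is_maxplus_op C ->
  rank1_bounded K R1 -> rank1_bounded K R2 -> y <= mp_apply C 0 0 k ->
  y - 2 * K <= mp_apply R2 (mp_apply C (mp_apply R1 0)) 0 i.
Proof.
move=> h1 h2 hC r1 r2 yC.
have : y - K <= mp_apply C (mp_apply R1 0) 0 k.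
  rewrite lerBlDr; apply: (le_trans yC); apply: mp_apply_le => // j.
  have : (0 : R) <= (0 : 'rV[R]_d) 0 j by rewrite mxE.
  by move=> /(mp_apply_bounded_ge j h1 r1) h; rewrite [X in X <= _]mxE; lra.
by move=> /(mp_apply_bounded_ge i h2 r2); lra.
Qed.

Lemma mp_sandwich_le (R1 R2 C : 'M[\bar R]_d) (K y : R) i :
  is_maxplus_op R1 -> is_maxplus_op R2 -> is_maxplus_op C ->
  rank1_bounded K R1 -> rank1_bounded K R2 -> (forall k, mp_apply C 0 0 k <= y) ->
  mp_apply R2 (mp_apply C (mp_apply R1 0)) 0 i <= y + 2 * K.
Proof.
move=> h1 h2 hC r1 r2 yC.
have : mp_apply R2 (mp_apply C (mp_apply R1 0)) 0 i <= (y + K) + K.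
  apply: (mp_apply_bounded_le i h2 r2) => k.
  apply: (@le_trans _ _ (mp_apply C 0 0 k + K)); last by have := yC k; lra.
  apply: mp_apply_le => // j.
  have e0 l : (0 : 'rV[R]_d) 0 l = 0 by rewrite mxE.
  by rewrite e0; apply: (mp_apply_bounded_le j h1 r1) => l; rewrite e0.
lra.
Qed.

End Operators.

(** * The space of operator sequences *)

Section SequenceSpace.
Variables (R : realType) (d : nat).

(* Sequences of operators rather than of arbitrary matrices, so that products and
   iterates compose everywhere and not only almost everywhere. *)
Record opseq := OpSeq {
  opseq_fun :> nat -> 'M[\bar R]_d ;
  opseqP : forall k, is_maxplus_op (opseq_fun k) }.

HB.instance Definition _ := gen_eqMixin opseq.
HB.instance Definition _ := gen_choiceMixin opseq.
HB.instance Definition _ := isPointed.Build opseq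
  (OpSeq (fun=> is_maxplus_op_id R d)).

Lemma opseq_eq (u v : opseq) : (forall k, u k = v k) -> u = v.
Proof.
case: u v => [u pu] [v pv] /= /funext uv; subst v.
by congr OpSeq; exact: Prop_irrelevance.
Qed.

Definition cylinder (B : nat -> 'I_d -> 'I_d -> set (\bar R)) : set opseq :=
  [set u : opseq | forall n i j, B n i j (u n i j)].

Definition finitary (K : nat) (B : nat -> 'I_d -> 'I_d -> set (\bar R)) :=
  (forall n i j, measurable (B n i j)) /\
  (forall n i j, (K <= n)%N -> B n i j = setT).

Definition cylinders : set (set opseq) :=
  [set C | exists K B, finitary K B /\ C = cylinder B].

Lemma cylindersI : setI_closed cylinders.
Proof.
move=> C C' [K [B [[mB BT] ->]]] [K' [B' [[mB' B'T] ->]]].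
exists (maxn K K'), (fun n i j => B n i j `&` B' n i j); split.
  split=> [n i j|n i j]; first exact: measurableI.
  by rewrite geq_max => /andP[h h']; rewrite BT// B'T// setIT.
apply/seteqP; split=> [u [uB uB'] n i j|u h]; first by split.
by split=> n i j; have [] := h n i j.
Qed.

Lemma cylindersT : cylinders setT.
Proof.
exists 0%N, (fun _ _ _ => setT); split; first by split=> *; [exact: measurableT|].
by apply/seteqP; split.
Qed.

End SequenceSpace.

Notation seqspace R d := (g_sigma_algebraType (@cylinders R d)).

(** * Product laws: concatenation and resampling of sequences *)

Section Law.
Variables (R : realType) (d : nat).
Local Notation S := (seqspace R d).
Implicit Types B : nat -> 'I_d -> 'I_d -> set (\bar R).

Lemma measurable_cylinder K B : finitary K B -> measurable (cylinder B : set S).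
Proof. by move=> h; apply: sub_gen_smallest; exists K, B. Qed.

Lemma measurable_to_seqspace d0 (T : measurableType d0) (f : T -> S) :
  (forall K B, finitary K B -> measurable (f @^-1` cylinder B)) ->
  measurable_fun setT f.
Proof.
move=> h.
have sub : preimage_set_system setT f (@cylinders R d) `<=` measurable.
  by move=> _ [_ [K [B [fB ->]]] <-]; rewrite setTI; exact: (h K).
exact: (@measurability _ _ T S setT f (@cylinders R d) erefl sub).
Qed.

Lemma measurable_entry k i j : measurable_fun setT (fun u : S => u k i j).
Proof.
move=> _ Y mY; rewrite setTI.
pose B n (i' j' : 'I_d) : set (\bar R) :=
  if [&& n == k, i' == i & j' == j] then Y else setT.
rewrite (_ : _ @^-1` _ = cylinder B); last first.
  apply/seteqP; split=> u /=.
    by move=> uY n i' j'; rewrite /B; case: ifP => // /and3P[/eqP -> /eqP -> /eqP ->].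
  by move=> /(_ k i j); rewrite /B !eqxx.
apply: (@measurable_cylinder k.+1); split=> n i' j'; rewrite /B; case: ifP => //.
by move=> /and3P[/eqP -> _ _]; rewrite ltnn.
Qed.

Definition splice (m : nat) (u v : S) : S :=
  @OpSeq R d (fun k => if (k < m)%N then u k else v (k - m)%N)
    (fun k => match (k < m)%N as b
       return is_maxplus_op (if b then u k else v (k - m)%N) with
       | true => opseqP u k | false => opseqP v (k - m)%N end).

Definition resample (m n : nat) (u v : S) : S :=
  @OpSeq R d (fun k => if (m <= k < n)%N then v k else u k)
    (fun k => match (m <= k < n)%N as b
       return is_maxplus_op (if b then v k else u k) with
       | true => opseqP v k | false => opseqP u k end).

Definition seqshift (n : nat) (u : S) : S :=
  @OpSeq R d (fun k => u (n + k)%N) (fun k => opseqP u (n + k)%N).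

Lemma shift_splice m u v : seqshift m (splice m u v) = v.
Proof.
by apply: opseq_eq => k /=; rewrite ltnNge leq_addr /= addKn.
Qed.

Lemma splice_preimage m B :
  (fun z : S * S => splice m z.1 z.2) @^-1` cylinder B =
  cylinder (fun k i j => if (k < m)%N then B k i j else setT) `*`
  cylinder (fun k => B (m + k)%N).
Proof.
apply/seteqP; split=> [[u v] /= h|[u v] /= [hu hv] k i j].
  split=> /= k i j; first by case: ifP => // km; have := h k i j; rewrite /= km.
  by have := h (m + k)%N i j; rewrite /= ltnNge leq_addr /= addKn.
rewrite /=; case: ifP => km; first by have := hu k i j; rewrite km.
have := hv (k - m)%N i j; rewrite subnKC //; move/negbT: km; by rewrite -leqNgt.
Qed.

Lemma resample_preimage m n B :
  (fun z : S * S => resample m n z.1 z.2) @^-1` cylinder B =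
  cylinder (fun k i j => if (m <= k < n)%N then setT else B k i j) `*`
  cylinder (fun k i j => if (m <= k < n)%N then B k i j else setT).
Proof.
apply/seteqP; split=> [[u v] /= h|[u v] /= [hu hv] k i j].
  by split=> /= k i j; have := h k i j => /=; case: ifP.
by rewrite /=; have := hu k i j; have := hv k i j; case: ifP.
Qed.

Lemma shift_preimage n B : seqshift n @^-1` cylinder B =
  cylinder (fun k i j => if (k < n)%N then setT else B (k - n)%N i j).
Proof.
apply/seteqP; split=> u h k i j.
  case: ifP => // /negbT; rewrite -leqNgt => nk.
  by have := h (k - n)%N i j; rewrite /= subnKC.
by have := h (n + k)%N i j; rewrite /= ltnNge leq_addr /= addKn.
Qed.

Lemma finitary_lt m K B : finitary K B ->
  finitary m (fun k i j => if (k < m)%N then B k i j else setT).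
Proof.
move=> [mB BT]; split=> k i j; first by case: ifP.
by rewrite leqNgt => /negbTE ->.
Qed.

Lemma finitary_add m K B : finitary K B -> finitary K (fun k => B (m + k)%N).
Proof. by move=> [mB BT]; split=> k i j // h; apply: BT; rewrite (leq_trans h)// leq_addl. Qed.

Lemma finitary_in m n K B : finitary K B ->
  finitary K (fun k i j => if (m <= k < n)%N then B k i j else setT).
Proof. by move=> [mB BT]; split=> k i j; case: ifP => // _ h; apply: BT. Qed.

Lemma finitary_out m n K B : finitary K B ->
  finitary K (fun k i j => if (m <= k < n)%N then setT else B k i j).
Proof. by move=> [mB BT]; split=> k i j; case: ifP => // _ h; apply: BT. Qed.

Lemma finitary_shift n K B : finitary K B ->
  finitary (n + K) (fun k i j => if (k < n)%N then setT else B (k - n)%N i j).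
Proof.
move=> [mB BT]; split=> k i j; case: ifP => // _ h; apply: BT.
by rewrite leq_subRL// (leq_trans _ h)// leq_addr.
Qed.

Lemma measurable_splice m :
  measurable_fun setT (fun z : S * S => splice m z.1 z.2).
Proof.
apply: measurable_to_seqspace => K B fB; rewrite splice_preimage.
apply: measurableX.
  exact: measurable_cylinder (finitary_lt m fB).
exact: measurable_cylinder (finitary_add m fB).
Qed.

Lemma measurable_resample m n :
  measurable_fun setT (fun z : S * S => resample m n z.1 z.2).
Proof.
apply: measurable_to_seqspace => K B fB; rewrite resample_preimage.
apply: measurableX.
  exact: measurable_cylinder (finitary_out m n fB).
exact: measurable_cylinder (finitary_in m n fB).
Qed.

Lemma measurable_shift n : measurable_fun setT (seqshift n).
Proof.
apply: measurable_to_seqspace => K B fB; rewrite shift_preimage.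
exact: measurable_cylinder (finitary_shift n fB).
Qed.

Variables (Q : probability S R) (p : ('I_d -> 'I_d -> set (\bar R)) -> R).
Hypothesis Qp : forall K (B : nat -> 'I_d -> 'I_d -> set (\bar R)), finitary K B ->
  Q (cylinder B) = (\prod_(k < K) p (B k))%:E.

(** Independence and identical distribution enter only through the product formula on cylinders, [p]
    giving the weight of one box. Cylinders are stable under intersection and generate the
    sigma-algebra, so they determine the law. *)
Lemma law_unique (mu : {measure set S -> \bar R}) :
  (forall K B, finitary K B -> mu (cylinder B) = Q (cylinder B)) ->
  forall E, measurable E -> mu E = Q E.
Proof.
move=> h E mE.
have cov : \bigcup_(k : nat) (fun=> [set: S]) k = setT by rewrite bigcup_const.
refine (@measure_unique _ R S (@cylinders R d) (fun=> setT) erefl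
  (@cylindersI R d) (fun=> cylindersT R d) cov mu Q _ _ E mE).
  by move=> _ [K [B [fB ->]]]; exact: h fB.
move=> _; have [K [B [fB BT]]] := cylindersT R d.
by rewrite BT (h _ _ fB) (Qp fB) ltry.
Qed.

Lemma pT : p (fun _ _ => setT) = 1.
Proof.
have f1 : finitary 1 (fun (_ : nat) (_ _ : 'I_d) => [set: \bar R]).
  by split=> *; [exact: measurableT|].
have := @Qp 1%N _ f1; rewrite big_ord1.
rewrite (_ : cylinder _ = setT); last by apply/seteqP; split.
by rewrite probability_setT => -[].
Qed.

Lemma pushforward_law (J : S * S -> S) (mJ : measurable_fun setT J) :
  (forall K B, finitary K B ->
     (Q \x Q)%E (J @^-1` cylinder B) = Q (cylinder B)) ->
  forall E, measurable E -> (Q \x Q)%E (J @^-1` E) = Q E.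
Proof.
move=> h E mE.
pose JP := HB.pack J (isMeasurableFun.Build _ _ _ _ _ mJ) : {mfun _ >-> _}.
exact: (@law_unique (pushforward (Q \x Q)%E JP)).
Qed.

Lemma prodQX (E1 E2 : set S) : measurable E1 -> measurable E2 ->
  (Q \x Q)%E (E1 `*` E2) = (Q E1 * Q E2)%E.
Proof. by move=> m1 m2; rewrite product_measure1E. Qed.

(** The Markov property at time [m]: the operators after time [m] may be replaced by a fresh
    independent sequence. *)
Lemma splice_law m E : measurable E ->
  (Q \x Q)%E ((fun z : S * S => splice m z.1 z.2) @^-1` E) = Q E.
Proof.
apply: (pushforward_law (measurable_splice m)) => K B fB.
have f1 := finitary_lt m fB; have f2 := finitary_add m fB.
rewrite splice_preimage prodQX; last 2 first.
- exact: measurable_cylinder f1.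
- exact: measurable_cylinder f2.
(* Enlarging the bound to [m + K] makes the product split at [m] without comparing [m] and [K]. *)
have f3 : finitary (m + K) B.
  by split=> [|k i j h]; [exact: fB.1|apply: fB.2; rewrite (leq_trans _ h)// leq_addl].
rewrite (Qp f1) (Qp f2) (Qp f3) -EFinM big_split_ord /=; congr (_ * _)%:E.
by apply: eq_bigr => k _; rewrite ltn_ord.
Qed.

(** The original sequence and the one with a renewed window have the same law: they form a coupling
    that differs in that window only. *)
Lemma resample_law m n E : measurable E ->
  (Q \x Q)%E ((fun z : S * S => resample m n z.1 z.2) @^-1` E) = Q E.
Proof.
apply: (pushforward_law (measurable_resample m n)) => K B fB.
have f1 := finitary_out m n fB; have f2 := finitary_in m n fB.
rewrite resample_preimage prodQX; last 2 first.
- exact: measurable_cylinder f1.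
- exact: measurable_cylinder f2.
rewrite (Qp f1) (Qp f2) (Qp fB) -EFinM -big_split /=; congr (_%:E).
by apply: eq_bigr => k _; case: (m <= k < n)%N; rewrite pT; [rewrite mul1r|rewrite mulr1].
Qed.

Lemma fst_law E : measurable E -> (Q \x Q)%E (fst @^-1` E) = Q E.
Proof.
move=> mE; rewrite (_ : fst @^-1` E = E `*` setT); last first.
  by apply/seteqP; split=> [[u v]|[u v] []].
by rewrite prodQX// probability_setT mule1.
Qed.

(** By independence, the probability of the concatenated event is at least the product of the two
    probabilities; this is how products with prescribed behaviour are shown to occur. *)
Lemma splice_pos m (E1 E2 E : set S) : measurable E1 -> measurable E2 ->
  measurable E -> (forall u v, E1 u -> E2 v -> E (splice m u v)) ->
  (0 < Q E1)%E -> (0 < Q E2)%E -> (0 < Q E)%E.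
Proof.
move=> mE1 mE2 mE h h1 h2; rewrite -(splice_law m mE).
apply: (@lt_le_trans _ _ ((Q \x Q)%E (E1 `*` E2))).
  by rewrite prodQX// mule_gt0.
apply: le_measure; rewrite ?inE; first exact: measurableX.
  by rewrite -[X in measurable X]setTI; exact: measurable_splice.
by move=> [u v] [/= hu hv]; exact: h.
Qed.

Lemma prodQT : (Q \x Q)%E setT = 1%E.
Proof. by rewrite -setXTT prodQX// probability_setT mule1. Qed.

Lemma prodQ_lty : ((Q \x Q)%E setT < +oo)%E.
Proof. by rewrite prodQT ltry. Qed.

Lemma Q_lty : (Q setT < +oo)%E.
Proof. by rewrite probability_setT ltry. Qed.

Lemma bounded_integrable d0 (T : measurableType d0) (mu : {measure set T -> \bar R})
  (f : T -> R) (M : R) : (mu setT < +oo)%E -> measurable_fun setT f ->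
  (forall x, `|f x| <= M) -> mu.-integrable setT (EFin \o f).
Proof.
move=> muT mf fM; apply: measurable_bounded_integrable => //.
exists M; split; first exact: num_real.
by move=> y My x _; apply: le_trans (fM x) (ltW My).
Qed.

Lemma Rintegral_law (J : S * S -> S) (mJ : measurable_fun setT J)
  (F : S -> R) (M : R) :
  (forall E, measurable E -> (Q \x Q)%E (J @^-1` E) = Q E) ->
  measurable_fun setT F -> (forall w, `|F w| <= M) ->
  \int[Q]_w F w = \int[(Q \x Q)%E]_z F (J z).
Proof.
move=> h mF FM; rewrite /Rintegral; congr fine.
have mF' : measurable_fun setT (EFin \o F) by exact/measurable_EFinP.
have i2 : (Q \x Q)%E.-integrable setT ((EFin \o F) \o J).
  apply: (@bounded_integrable _ _ _ (F \o J) M prodQ_lty); first exact: measurableT_comp.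
  by move=> z; exact: FM.
pose JP := HB.pack J (isMeasurableFun.Build _ _ _ _ _ mJ) : {mfun _ >-> _}.
have e := @integral_pushforward _ _ _ _ R J mJ (Q \x Q)%E setT (EFin \o F) mF'.
rewrite -(preimage_setT J) in i2.
have {e} := e i2 measurableT; rewrite preimage_setT => e.
apply: (etrans _ e).
apply: (@eq_measure_integral _ _ _ _ (pushforward (Q \x Q)%E JP)) => E mE _.
exact: esym (h E mE).
Qed.

Lemma Rintegral_fubini (G : S * S -> R) (M : R) : measurable_fun setT G ->
  (forall z, `|G z| <= M) ->
  [/\ measurable_fun setT (fun u => \int[Q]_v G (u, v)),
      (forall u, `|\int[Q]_v G (u, v)| <= M) &
      \int[(Q \x Q)%E]_z G z = \int[Q]_u \int[Q]_v G (u, v)].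
Proof.
move=> mG GM.
have iG : (Q \x Q)%E.-integrable setT (EFin \o G).
  exact: (bounded_integrable prodQ_lty mG GM).
have mGu u : measurable_fun setT (fun v => G (u, v)).
  exact: (measurable_fun_pair2 u mG).
have iGu u : Q.-integrable setT (EFin \o (fun v => G (u, v))).
  by apply: (bounded_integrable Q_lty (mGu u) (M := M)).
have FE u : fubini_F Q (EFin \o G) u = (\int[Q]_v G (u, v))%:E.
  by rewrite /fubini_F /Rintegral fineK//; exact: integrable_fin_num (iGu u).
split.
- apply/measurable_EFinP.
  rewrite (_ : EFin \o _ = fubini_F Q (EFin \o G)); first exact: measurable_fubini_F iG.
  by apply/funext => u; rewrite FE.
- move=> u; apply: (le_trans (le_normr_Rintegral _ (iGu u))) => //.
  apply: (@le_trans _ _ (\int[Q]_v M)).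
    apply: le_Rintegral => //; first exact: integrable_norm (iGu u).
    by apply: (bounded_integrable Q_lty (M := `|M|)).
  have e : fine (Q setT) = 1 by rewrite probability_setT.
  by rewrite Rintegral_cst// [X in _ * X]e mulr1.
- rewrite /Rintegral -integral12_prod_meas1//; congr fine.
  by apply: eq_integral => u _; rewrite FE.
Qed.

End Law.

Arguments measurable_splice {R d}.
Arguments measurable_resample {R d}.
Arguments measurable_shift {R d}.

(** * Products and orbits along a sequence, and their measurability *)

Section Dynamics.
Variables (R : realType) (d : nat).
Local Notation S := (seqspace R d).
Implicit Types (u v : S) (x y : 'rV[R]_d).

(** Indices start at 0: [u k] stands for A(k+1), so that [prodseq u n] is A(n)...A(1). *)
Fixpoint prodseq (u : nat -> 'M[\bar R]_d) n : 'M[\bar R]_d :=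
  if n is m.+1 then mp_mul (u m) (prodseq u m) else mp_id R d.

Lemma prodseq_op u n : is_maxplus_op (prodseq u n).
Proof.
elim: n => [|n IH] /=; first exact: is_maxplus_op_id.
exact: is_maxplus_op_mul (opseqP u n) IH.
Qed.

Lemma prodseq_eq (u v : nat -> 'M[\bar R]_d) n :
  (forall k, (k < n)%N -> u k = v k) -> prodseq u n = prodseq v n.
Proof.
elim: n => //= n IH h; rewrite h// IH// => k kn.
by apply: h; rewrite ltnW.
Qed.

Lemma prodseqD u m n :
  prodseq u (m + n) = mp_mul (prodseq (seqshift m u) n) (prodseq u m).
Proof.
elim: n => [|n IH]; first by rewrite addn0 /= mp_mul1.
by rewrite addnS /= IH mp_mulA.
Qed.

Lemma prodseq_splice u v m : prodseq (splice m u v) m = prodseq u m.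
Proof. by apply: prodseq_eq => k km /=; rewrite km. Qed.

Lemma prodseq_spliceD u v m n :
  prodseq (splice m u v) (m + n) = mp_mul (prodseq v n) (prodseq u m).
Proof. by rewrite prodseqD shift_splice prodseq_splice. Qed.

Lemma measurable_bigmaxe d0 (T : measurableType d0) (I : finType)
  (F : I -> T -> \bar R) : (forall i, measurable_fun setT (F i)) ->
  measurable_fun setT (fun t => \big[maxe/-oo%E]_i F i t).
Proof.
move=> mF.
have h (s : seq I) : measurable_fun setT (fun t => \big[maxe/-oo%E]_(i <- s) F i t).
  elim: s => [|i s IH].
    by under eq_fun do rewrite big_nil; exact: measurable_cst.
  by under eq_fun do rewrite big_cons; apply: measurable_maxe.
exact: (h (index_enum I)).
Qed.

Lemma measurable_prodseq n i j : measurable_fun setT (fun u : S => prodseq u n i j).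
Proof.
elim: n i j => [|n IH] i j /=; first by exact: measurable_cst.
under eq_fun do rewrite mxE.
apply: measurable_bigmaxe => p; apply: emeasurable_funD => //.
exact: measurable_entry.
Qed.

Definition out n x i (u : S) : R := mp_apply (prodseq u n) x 0 i.

Lemma measurable_out n x i : measurable_fun setT (out n x i).
Proof.
rewrite /out; under eq_fun do rewrite mxE.
apply: (measurableT_comp (fine_measurable measurableT)).
apply: measurable_bigmaxe => p; apply: emeasurable_funD => //.
exact: measurable_prodseq.
Qed.

Lemma measurable_forall_fin d0 (T : measurableType d0) (I : finType)
  (P : I -> set T) : (forall i, measurable (P i)) ->
  measurable [set t | forall i, P i t].
Proof.
move=> mP; rewrite (_ : [set t | _] = \bigcap_(i in [set: I]) P i).
  by apply: fin_bigcap_measurable => //; exact: finite_finset.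
by apply/seteqP; split=> t /= h i; [move=> _|]; apply: h.
Qed.

Lemma measurable_exists_fin d0 (T : measurableType d0) (I : finType)
  (P : I -> set T) : (forall i, measurable (P i)) ->
  measurable [set t | exists i, P i t].
Proof.
move=> mP; rewrite (_ : [set t | _] = \bigcup_(i in [set: I]) P i).
  by apply: fin_bigcup_measurable => //; exact: finite_finset.
by apply/seteqP; split=> t /= [i]; [exists i|move=> _; exists i].
Qed.

Lemma measurable_rank1_eq n : measurable [set u : S | forall i k j,
  (prodseq u n i j + rowmax (prodseq u n) k =
   prodseq u n k j + rowmax (prodseq u n) i)%E].
Proof.
apply: measurable_forall_fin => i; apply: measurable_forall_fin => k.
apply: measurable_forall_fin => j; rewrite -[X in measurable X]setTI.
have mr l : measurable_fun setT (fun u : S => rowmax (prodseq u n) l).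
  by apply: measurable_bigmaxe => p; exact: measurable_prodseq.
by apply: measurable_eqe => //; apply: emeasurable_funD => //; exact: measurable_prodseq.
Qed.

Lemma measurable_rank1_bounded (K : R) n :
  measurable [set u : S | rank1_bounded K (prodseq u n)].
Proof.
apply: measurableI; first exact: measurable_rank1_eq.
apply: measurable_forall_fin => i; apply: measurable_forall_fin => j.
have m := @measurable_prodseq n i j.
apply: measurableI; rewrite -[X in measurable X]setTI.
  by apply: emeasurable_fun_c_infty.
by apply: emeasurable_fun_infty_c.
Qed.

End Dynamics.

Section Measures.

Lemma measurable_fun_cos d0 (T : measurableType d0) (R : realType) (f : T -> R) :
  measurable_fun setT f -> measurable_fun setT (fun t => cos (f t)).
Proof.
exact: (measurableT_comp (continuous_measurable_fun (@continuous_cos R))).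
Qed.

Local Open Scope ereal_scope.

Lemma bigcup_pos d0 (T : measurableType d0) (R : realType)
  (mu : {measure set T -> \bar R}) (F : nat -> set T) :
  (forall n, measurable (F n)) -> 0 < mu (\bigcup_n F n) -> exists n, 0 < mu (F n).
Proof.
move=> mF; apply: contraPP => /forallNP h; apply/negP; rewrite -leNgt.
have : mu.-negligible (\bigcup_n F n).
  apply: negligible_bigcup => n; apply/negligibleP => //.
  by apply/eqP; rewrite eq_le measure_ge0 andbT leNgt; apply/negP; exact: h.
move/negligibleP => -> //; exact: bigcupT_measurable.
Qed.

(** A truncation: the event is the increasing union of its parts where [f] is bounded by an integer,
    and one of them keeps positive mass. *)
Lemma bounded_pos d0 (T : measurableType d0) (R : realType)
  (mu : {measure set T -> \bar R}) (E : set T) (f : T -> R) :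
  measurable E -> measurable_fun setT f -> 0 < mu E ->
  exists n : nat, 0 < mu (E `&` [set t | (`|f t| <= n%:R)%R]).
Proof.
move=> mE mf E0; apply: (@bigcup_pos _ _ _ mu (fun n => E `&` [set t | (`|f t| <= n%:R)%R])).
  move=> n; apply: measurableI => //; rewrite -[X in measurable X]setTI.
  by apply: measurable_fun_le => //; apply: measurableT_comp.
rewrite -setI_bigcupr (_ : \bigcup_n _ = setT) ?setIT//.
apply/seteqP; split=> // t _; exists (Num.trunc `|f t|).+1 => //=.
by apply/ltW; rewrite truncnS_gt.
Qed.

End Measures.

(** * Contraction of the characteristic function *)

Lemma cosD_midpoint (R : realType) (s a c : R) :
  cos (s * a) + cos (s * (a + c)) = 2 * cos (s * c / 2) * cos (s * (a + c / 2)).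
Proof.
have -> : s * a = s * (a + c / 2) - s * c / 2 by field.
have -> : s * (a + c) = s * (a + c / 2) + s * c / 2 by field.
by rewrite cosB cosD; ring.
Qed.

Section Contraction.
Variables (R : realType) (d : nat).
Local Notation S := (seqspace R d).
Variables (Q : probability S R) (p : ('I_d -> 'I_d -> set (\bar R)) -> R).
Hypothesis Qp : forall K (B : nat -> 'I_d -> 'I_d -> set (\bar R)), finitary K B ->
  Q (cylinder B) = (\prod_(k < K) p (B k))%:E.
Variables (N l : nat) (K : R) (i0 : 'I_d).
Let L := (N + (l + N))%N.
Implicit Types (u v : S) (x y : 'rV[R]_d).

Let mid u := seqshift N u.
Let top u := seqshift l (mid u).
Let tau (z : S * S) : S := resample N (N + l) z.1 z.2.

Definition renewal_ends : set S :=
  [set u : S | rank1_bounded K (prodseq u N) /\ rank1_bounded K (prodseq (top u) N)].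

Lemma measurable_renewal_ends : measurable renewal_ends.
Proof.
apply: measurableI; first exact: measurable_rank1_bounded.
rewrite -[X in measurable X]setTI.
have m : measurable_fun setT (fun u : S => top u).
  exact: (measurableT_comp (measurable_shift l) (measurable_shift N)).
exact: (m measurableT _ (measurable_rank1_bounded K N)).
Qed.

Lemma out_block u x i : out L x i u =
  mp_apply (prodseq (top u) N) (mp_apply (prodseq (mid u) l)
    (mp_apply (prodseq u N) x)) 0 i.
Proof.
rewrite /out /L !prodseqD !mp_apply_mul//; try exact: prodseq_op.
by apply: is_maxplus_op_mul; exact: prodseq_op.
Qed.

Lemma out_tau u v x i : out L x i (tau (u, v)) =
  mp_apply (prodseq (top u) N) (mp_apply (prodseq (mid v) l)
    (mp_apply (prodseq u N) x)) 0 i.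
Proof.
rewrite out_block; congr (mp_apply _ (mp_apply _ (mp_apply _ _)) _ _).
- apply: prodseq_eq => k _ /=.
  by rewrite addnA ltnNge leq_addr andbF.
- apply: prodseq_eq => k kl /=.
  by rewrite leq_addr ltn_add2l kl.
- by apply: prodseq_eq => k kN /=; rewrite leqNgt kN.
Qed.

(** The start 0 and the coordinate [i0] are arbitrary choices: on [renewal_ends] every other choice
    gives the same value, by [out_tau_jump]. *)
Definition jump (z : S * S) : R := out L 0 i0 (tau z) - out L 0 i0 z.1.

Lemma out_tau_jump u v x i : renewal_ends u ->
  out L x i (tau (u, v)) = out L x i u + jump (u, v).
Proof.
move=> [r1 r2]; rewrite /jump !out_tau -[(u, v).1]/u !out_block.
apply: mp_rank1_exchange; try exact: prodseq_op.
- exact: ((mp_rank1P (prodseq_op _ _)).2 r1.1).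
- exact: ((mp_rank1P (prodseq_op _ _)).2 r2.1).
Qed.

Let measurable_tau : measurable_fun setT tau.
Proof. exact: measurable_resample. Qed.

Lemma measurable_jump : measurable_fun setT jump.
Proof.
apply: measurable_funB.
  by apply: measurableT_comp => //; exact: measurable_out.
by apply: measurableT_comp => //; exact: measurable_out.
Qed.

(** The factor gained in one block. Off [renewal_ends] the jump has no meaning for other inputs, and
    the value 1 records that nothing is gained. *)
Definition damping (s : R) (z : S * S) : R :=
  if `[< renewal_ends z.1 >] then `|cos (s * jump z / 2)| else 1.

Lemma damping_bounds s z : 0 <= damping s z <= 1.
Proof.
rewrite /damping; case: asboolP => _; last by rewrite ler01 lexx.
by rewrite normr_ge0 ler_norml cos_geN1 cos_le1.
Qed.

Lemma measurable_damping s : measurable_fun setT (damping s).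
Proof.
apply: measurable_fun_ifT => //.
- apply: (@measurable_fun_bool _ _ _ _ true); rewrite setTI.
  rewrite (_ : _ @^-1` _ = fst @^-1` renewal_ends); last first.
    by apply/seteqP; split=> z /=; [move/asboolP|move=> h; apply/asboolP].
  rewrite -[X in measurable X]setTI; apply: measurable_fst => //.
  exact: measurable_renewal_ends.
- apply: measurableT_comp => //; apply: measurable_fun_cos.
  apply: measurable_funM => //; apply: measurable_funM => //.
  exact: measurable_jump.
Qed.

Lemma measurable_cos_out (s : R) n x i :
  measurable_fun setT (fun u : S => cos (s * out n x i u)).
Proof.
apply: measurable_fun_cos.
by apply: measurable_funM => //; exact: measurable_out.
Qed.

Lemma norm_cos_le1 (a : R) : `|cos a| <= 1.
Proof. by rewrite ler_norml cos_geN1 cos_le1. Qed.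

Lemma integrable_cos_out (s : R) n x i :
  Q.-integrable setT (EFin \o (fun u : S => cos (s * out n x i u))).
Proof.
apply: (bounded_integrable (Q_lty Q) (M := 1)) => [|w].
  exact: measurable_cos_out.
exact: norm_cos_le1.
Qed.

(** After the first block, the expectation is that of [H], a function of the vector reached. Its
    mean is half the mean of [H] over the two members of the coupling, whose vectors differ by a
    constant on [renewal_ends]. The uniformity of [D] over starting vectors is essential, since the
    vector reached is random. *)
Lemma contraction (s D : R) n :
  (forall y, `|\int[Q]_v cos (s * out n y i0 v)| <= D) ->
  forall x, `|\int[Q]_u cos (s * out (L + n) x i0 u)|
            <= D * \int[(Q \x Q)%E]_z damping s z.
Proof.
move=> hD x.
have D0 : 0 <= D by apply: le_trans (hD 0).
pose F (w : S) := cos (s * out (L + n) x i0 w).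
pose g y := \int[Q]_v cos (s * out n y i0 v).
pose H (u : S) := g (mp_apply (prodseq u L) x).
have mF : measurable_fun setT F by exact: measurable_cos_out.
have F1 w : `|F w| <= 1 by exact: norm_cos_le1.
pose G (z : S * S) := F (splice L z.1 z.2).
have mG : measurable_fun setT G.
  by apply: measurableT_comp => //; exact: measurable_splice.
have GE u v : G (u, v) = cos (s * out n (mp_apply (prodseq u L) x) i0 v).
  rewrite /G /F /out prodseq_spliceD mp_apply_mul//; exact: prodseq_op.
have [mH H1 FH] := Rintegral_fubini Q mG (fun z => F1 _).
have HE u : \int[Q]_v G (u, v) = H u.
  by rewrite /H /g; apply: eq_Rintegral => v _; rewrite GE.
have mH' : measurable_fun setT H.
  by rewrite (_ : H = fun u => \int[Q]_v G (u, v)) //; apply/funext => u; rewrite HE.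
have H1' u : `|H u| <= 1 by rewrite -HE.
(* The Markov property at time [L]. *)
have e0 : \int[Q]_u F u = \int[Q]_u H u.
  rewrite (Rintegral_law (measurable_splice L) (splice_law Qp L) mF F1).
  by rewrite [LHS]FH; apply: eq_Rintegral => u _; rewrite HE.
(* Both marginals of the coupling have law [Q], so twice the mean of [H] is the mean of
   [H z.1 + H (tau z)]. *)
have e1 := Rintegral_law measurable_fst (fst_law Q) mH' H1'.
have e2 := Rintegral_law measurable_tau (resample_law Qp N (N + l)) mH' H1'.
have i1 : (Q \x Q)%E.-integrable setT (EFin \o (fun z => H z.1)).
  apply: (bounded_integrable (prodQ_lty Q) (M := 1)) => [|z]; last exact: H1'.
  by apply: measurableT_comp => //; exact: measurable_fst.
have i2 : (Q \x Q)%E.-integrable setT (EFin \o (fun z => H (tau z))).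
  apply: (bounded_integrable (prodQ_lty Q) (M := 1)) => [|z]; last exact: H1'.
  exact: measurableT_comp.
have i3 : (Q \x Q)%E.-integrable setT (EFin \o (fun z => H z.1 + H (tau z))).
  rewrite (_ : EFin \o _ = ((EFin \o (fun z => H z.1)) \+ (EFin \o (fun z => H (tau z))))%E).
    exact: integrableD.
  by apply/funext => z /=; rewrite EFinD.
have idamp : (Q \x Q)%E.-integrable setT (EFin \o damping s).
  apply: (bounded_integrable (prodQ_lty Q) (M := 1)) => [|z]; first exact: measurable_damping.
  by have /andP[h0 h1] := damping_bounds s z; rewrite ger0_norm.
have pt z : `|H z.1 + H (tau z)| <= 2 * D * damping s z.
  case: z => u v /=.
  have hH w : `|H w| <= D by exact: hD.
  rewrite /damping; case: asboolP => [r|_]; last first.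
    rewrite mulr1 (le_trans (ler_normD _ _))//.
    by rewrite mulr_natl mulr2n lerD.
  set c := jump (u, v).
  pose y := mp_apply (prodseq u L) x.
  have yt : mp_apply (prodseq (tau (u, v)) L) x = y + const_mx c.
    by apply/rowP => i; rewrite [RHS]mxE [const_mx _ _ _]mxE; exact: out_tau_jump.
  have sh t w : out n (y + const_mx t) i0 w = out n y i0 w + t.
    by rewrite /out mp_apply_shift//; exact: prodseq_op.
  (* The same future [w] is applied to [y] and to [y + c]. The midpoint formula leaves a cosine
     started from [y + c / 2], to which the uniform bound [D] applies again. *)
  have -> : H u + H (tau (u, v)) = 2 * cos (s * c / 2) * g (y + const_mx (c / 2)).
    rewrite /H yt /g -RintegralD//; last 2 first.
    - exact: integrable_cos_out.
    - exact: integrable_cos_out.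
    rewrite -RintegralZl//; last first.
      exact: integrable_cos_out.
    apply: eq_Rintegral => w _; rewrite !sh.
    exact: cosD_midpoint.
  rewrite !normrM ger0_norm// mulrAC ler_wpM2r//.
  by rewrite ler_wpM2l//; exact: hD.
have key : `|2 * \int[Q]_u F u| <= 2 * D * \int[(Q \x Q)%E]_z damping s z.
  rewrite e0 mulr2n mulrDl mul1r {1}e1 e2 -RintegralD//.
  apply: (le_trans (le_normr_Rintegral _ i3)) => //.
  rewrite -RintegralZl//; apply: le_Rintegral => //; first exact: integrable_norm i3.
  apply: (bounded_integrable (prodQ_lty Q) (M := 2 * D)) => [|z].
    by apply: measurable_funM => //; exact: measurable_damping.
  have /andP[h0 h1] := damping_bounds s z.
  by rewrite normrM !ger0_norm// ?mulr_ge0// ler_piMr// mulr_ge0.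
move: key; rewrite normrM ger0_norm// -mulrA ler_pM2l//; exact.
Qed.

(** The trivial bound 1 starts the induction; each block adds one factor because the bound obtained
    holds for all starting vectors. *)
Lemma contraction_iter (s : R) k x :
  `|\int[Q]_u cos (s * out (k * L) x i0 u)|
  <= (\int[(Q \x Q)%E]_z damping s z) ^+ k.
Proof.
elim: k x => [|k IH] x.
  rewrite expr0; apply: le_trans (le_normr_Rintegral _ _) _ => //.
    exact: integrable_cos_out.
  have ic : Q.-integrable setT (EFin \o (fun u : S => `|cos (s * out (0 * L) x i0 u)|)).
    apply: integrable_norm.
    exact: integrable_cos_out.
  apply: (@le_trans _ _ (\int[Q]_u (1 : R))).
    apply: le_Rintegral => //; last by move=> w _; exact: norm_cos_le1.
    by apply: (bounded_integrable (Q_lty Q) (M := 1)) => // w; rewrite normr1.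
  have e : fine (Q setT) = 1 by rewrite probability_setT.
  by rewrite Rintegral_cst// [X in _ * X]e mulr1.
by rewrite mulSn exprSr; exact: contraction.
Qed.

End Contraction.

(** The derivative of [sin] at 0 is 1, which exceeds 1/2. *)
Lemma sin_near0 (R : realType) :
  exists2 e : R, 0 < e & forall z, `|z| < e -> `|z| / 2 <= `|sin z|.
Proof.
have [ds es] := is_derive_sin (0 : R).
have cv : (fun h : R => h^-1 *: ((sin \o shift 0) (h *: 1) - sin 0)) @ 0^' --> (1 : R).
  by move: ds; rewrite /derivable => /cvgP; rewrite -[lim _]/('D_1 sin 0) es cos0.
have : \forall h \near (0 : R)^', 2^-1 < h^-1 *: ((sin \o shift 0) (h *: 1) - sin 0).
  apply: (cvgr_gt _ cv); lra.
move=> [e /= e0 He]; exists e => // z ze.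
have [->|z0] := eqVneq z 0; first by rewrite normr0 mul0r.
have := He z; rewrite /ball_ /= sub0r normrN => /(_ ze z0).
rewrite sin0 subr0 addr0 /GRing.scale /= mulr1 => h.
have : 2^-1 <= `|z^-1 * sin z| by apply: le_trans (ltW h) (ler_norm _).
rewrite normrM normfV mulrC ler_pdivlMr ?normr_gt0//.
by rewrite mulrC.
Qed.

(** The constant 8 comes from |cos z| <= (1 + cos^2 z)/2 = 1 - sin^2 z / 2 and |sin z| >= |z|/2. *)
Lemma abs_cos_near0 (R : realType) :
  exists2 e : R, 0 < e & forall z, `|z| < e -> `|cos z| <= 1 - z ^+ 2 / 8.
Proof.
have [e e0 he] := sin_near0 R; exists e => // z /he h.
have h2 : z ^+ 2 / 4 <= sin z ^+ 2.
  rewrite -(real_normK (num_real z)) -[sin z ^+ 2](real_normK (num_real _)).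
  by have := normr_ge0 z; nra.
have := cos2Dsin2 z; rewrite -[cos z ^+ 2](real_normK (num_real _)) => h3.
have : 0 <= (1 - `|cos z|) ^+ 2 by rewrite sqr_ge0.
nra.
Qed.

(** * Large jumps are incompatible with a degenerate limit *)

Section Fluctuation.
Variables (R : realType) (d : nat).
Local Notation S := (seqspace R d).
Variables (Q : probability S R) (p : ('I_d -> 'I_d -> set (\bar R)) -> R).
Hypothesis Qp : forall K (B : nat -> 'I_d -> 'I_d -> set (\bar R)), finitary K B ->
  Q (cylinder B) = (\prod_(k < K) p (B k))%:E.
Variables (N l : nat) (K : R) (i0 : 'I_d).
Let L := (N + (l + N))%N.
Implicit Types (u v : S) (x y : 'rV[R]_d).

Let active : set (S * S) :=
  [set z | renewal_ends N l K z.1 /\ 1 <= `|jump N l i0 z|].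

Let measurable_active : measurable active.
Proof.
apply: measurableI; rewrite -[X in measurable X]setTI.
  by apply: measurable_fst => //; exact: measurable_renewal_ends.
apply: measurable_fun_le => //; apply: measurableT_comp => //.
exact: measurable_jump.
Qed.

(** The original sequence is given a low middle factor between two bounded rank 1 factors, its copy
    a high one. Each sandwich costs [2 * K], hence [4 * K]; the remaining 1 is the size required of
    the jump. *)
Lemma active_pos (a b : R) :
  (0 < Q [set u | rank1_bounded K (prodseq u N)])%E ->
  (0 < Q [set u | forall i, (out l 0 i u <= a)%R])%E ->
  (0 < Q [set u | exists i, (b <= out l 0 i u)%R])%E ->
  a + 4 * K + 1 <= b -> (0 < (Q \x Q)%E active)%E.
Proof.
move=> rpos lpos hpos ab.
pose rk : set S := [set u : S | rank1_bounded K (prodseq u N)].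
pose lo : set S := [set u : S | forall i, (out l 0 i u <= a)%R].
pose hi : set S := [set u : S | exists i, (b <= out l 0 i u)%R].
have mrk : measurable rk by exact: measurable_rank1_bounded.
have mlo : measurable lo.
  apply: measurable_forall_fin => i; rewrite -[X in measurable X]setTI.
  by apply: measurable_fun_le => //; exact: measurable_out.
have mhi : measurable hi.
  apply: measurable_exists_fin => i; rewrite -[X in measurable X]setTI.
  by apply: measurable_fun_le => //; exact: measurable_out.
have ms n E : measurable E -> measurable (seqshift n @^-1` E : set S).
  by move=> mE; rewrite -[X in measurable X]setTI; exact: measurable_shift.
pose E1 : set S := lo `&` seqshift l @^-1` rk.
have E1pos : (0 < Q E1)%E.
  apply: (splice_pos Qp (m := l) mlo mrk) => //.
    by apply: measurableI => //; exact: ms.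
  move=> u v hu hv; split=> [i|]; last by rewrite /= shift_splice.
  by have := hu i; rewrite /out prodseq_splice.
pose G1 : set S := rk `&` seqshift N @^-1` E1.
have mE1 : measurable E1 by apply: measurableI => //; exact: ms.
have mG1 : measurable G1 by apply: measurableI => //; exact: ms.
have G1pos : (0 < Q G1)%E.
  apply: (splice_pos Qp (m := N) mrk mE1) => //.
  move=> u v hu hv; split; last by rewrite /= shift_splice.
  by rewrite /rk /= prodseq_splice.
pose G2 : set S := seqshift N @^-1` hi.
have mG2 : measurable G2 by exact: ms.
have G2pos : (0 < Q G2)%E.
  apply: (splice_pos Qp (m := N) measurableT mhi) => //.
    by move=> u v _ hv; rewrite /G2 /= shift_splice.
  by rewrite probability_setT.
apply: (@lt_le_trans _ _ ((Q \x Q)%E (G1 `*` G2))); first by rewrite prodQX// mule_gt0.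
apply: le_measure; rewrite ?inE//; first exact: measurableX.
move=> [u v] [/= [r1 [uE r2]] [k hv]].
split; first by split.
have op := @prodseq_op R d.
rewrite /jump out_tau out_block.
have h1 := mp_sandwich_ge i0 (op u N) (op _ N) (op (seqshift N v) l) r1 r2 hv.
have h2 := mp_sandwich_le i0 (op u N) (op _ N) (op (seqshift N u) l) r1 r2 uE.
apply: le_trans (ler_norm _).
rewrite lerBrDr; apply: le_trans h1; apply: (le_trans (lerD (lexx 1) h2)).
by lra.
Qed.

Lemma damping_integral_le : (0 < (Q \x Q)%E active)%E ->
  exists c s0 : R, [/\ 0 < c, 0 < s0 &
    forall s, 0 < s -> s < s0 ->
      \int[(Q \x Q)%E]_z damping N l K i0 s z <= 1 - c * s ^+ 2].
Proof.
move=> /(bounded_pos measurable_active (measurable_jump N l i0)) [n].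
set good := active `&` _ => good0.
have mgood : measurable good.
  apply: measurableI => //; rewrite -[X in measurable X]setTI.
  apply: measurable_fun_le => //; apply: measurableT_comp => //; exact: measurable_jump.
have [e e0 he] := abs_cos_near0 R.
pose q : R := fine ((Q \x Q)%E good).
have qfin : (Q \x Q)%E good \is a fin_num.
  rewrite ge0_fin_numE//; apply: le_lt_trans (prodQ_lty Q).
  by apply: le_measure; rewrite ?inE.
have q0 : 0 < q by rewrite fine_gt0// good0 -ge0_fin_numE.
have n1 : 0 < (n.+1%:R : R) by rewrite ltr0n.
(* On [good], of mass [q], the jump [j] satisfies 1 <= |j| <= [n]. The upper bound keeps [s * j / 2]
   below [e], and the lower one gives (s j / 2)^2 / 8 >= s^2 / 32. *)
exists (q / 32), (e / n.+1%:R); split; [by rewrite divr_gt0|by rewrite divr_gt0|].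
move=> s s0; rewrite ltr_pdivlMr// => se.
have iind : (Q \x Q)%E.-integrable setT (EFin \o \1_good).
  apply: (bounded_integrable (prodQ_lty Q) (M := 1)) => [|z]; first exact: measurable_indic.
  by rewrite indicE; case: (_ \in _); rewrite ?normr1 ?normr0.
have eind : \int[(Q \x Q)%E]_z \1_good z = q.
  by rewrite /Rintegral integral_indic// setIT.
have i1 : (Q \x Q)%E.-integrable setT (EFin \o (fun=> 1 : R)).
  by apply: (bounded_integrable (prodQ_lty Q) (M := 1)) => // z; rewrite normr1.
have i2 : (Q \x Q)%E.-integrable setT (EFin \o (fun z => s ^+ 2 / 32 * \1_good z)).
  apply: (bounded_integrable (prodQ_lty Q) (M := `|s ^+ 2 / 32|)) => [|z].
    by apply: measurable_funM => //; exact: measurable_indic.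
  rewrite normrM ler_piMr// indicE; case: (_ \in _); rewrite ?normr1 ?normr0//.
have i3 : (Q \x Q)%E.-integrable setT (EFin \o (fun z => 1 - s ^+ 2 / 32 * \1_good z)).
  apply: (bounded_integrable (prodQ_lty Q) (M := 1 + `|s ^+ 2 / 32|)) => [|z].
    by apply: measurable_funB => //; apply: measurable_funM => //; exact: measurable_indic.
  apply: (le_trans (ler_normB _ _)); rewrite normr1 lerD2l.
  rewrite normrM ler_piMr// indicE; case: (_ \in _); rewrite ?normr1 ?normr0//.
have idamp : (Q \x Q)%E.-integrable setT (EFin \o damping N l K i0 s).
  apply: (bounded_integrable (prodQ_lty Q) (M := 1)) => [|z]; first exact: measurable_damping.
  by have /andP[h0 h1] := damping_bounds N l K i0 s z; rewrite ger0_norm.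
apply: (@le_trans _ _ (\int[(Q \x Q)%E]_z (1 - s ^+ 2 / 32 * \1_good z))).
  apply: le_Rintegral => // z _; rewrite indicE.
  case: (boolP (z \in good)) => [|_]; last first.
    by rewrite mulr0 subr0; have /andP[] := damping_bounds N l K i0 s z.
  rewrite inE mulr1 => -[[rz j1] jn].
  rewrite /damping asboolT//.
  set j := jump N l i0 z in j1 jn *.
  have sj : `|s * j / 2| < e.
    rewrite normrM normrM (gtr0_norm s0) [X in _ * X < _]gtr0_norm ?invr_gt0//.
    have : s * `|j| <= s * n.+1%:R.
      by rewrite ler_pM2l// (le_trans jn)// ler_nat.
    have := mulr_ge0 (ltW s0) (normr_ge0 j); lra.
  apply: (le_trans (he _ sj)).
  have j2 : 1 <= j ^+ 2 by rewrite -(real_normK (num_real j)) expr_ge1.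
  rewrite lerD2l lerN2.
  have -> : (s * j / 2) ^+ 2 / 8 = s ^+ 2 / 32 * j ^+ 2 by field.
  by rewrite ler_peMr// divr_ge0// sqr_ge0.
rewrite RintegralB// RintegralZl// eind.
have -> : \int[(Q \x Q)%E]_z (1 : R) = 1.
  have e1 : fine ((Q \x Q)%E setT) = 1 by rewrite prodQT.
  by rewrite Rintegral_cst// [X in _ * X]e1 mulr1.
by rewrite lerD2l lerN2; have -> : q / 32 * s ^+ 2 = s ^+ 2 / 32 * q by field.
Qed.

(** At time [n = k * L] and frequency s = n^(-1/2), the [k] blocks give at most (1 - c s^2)^k <=
    exp(- c k / n) = exp(- c / L), a constant below 1, whereas a degenerate limit requires values
    close to 1. *)
Lemma fluctuation_contra (a b : R) : (0 < N)%N ->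
  (forall e : R, 0 < e -> exists n0 : nat, forall n, (n0 <= n)%N ->
     1 - e <= `|\int[Q]_u cos ((Num.sqrt n%:R)^-1 * out n 0 i0 u)|) ->
  (0 < Q [set u | rank1_bounded K (prodseq u N)])%E ->
  (0 < Q [set u | forall i, (out l 0 i u <= a)%R])%E ->
  (0 < Q [set u | exists i, (b <= out l 0 i u)%R])%E ->
  a + 4 * K + 1 <= b -> False.
Proof.
move=> N0 clt r h1 h2 ab.
have [c [s0 [c0 s00 hd]]] := damping_integral_le (active_pos r h1 h2 ab).
have L0 : (0 < L)%N by rewrite /L addn_gt0 N0.
have LR : 0 < (L%:R : R) by rewrite ltr0n.
pose rho : R := expR (- (c / L%:R)).
have rho1 : rho < 1.
  by rewrite /rho -[ltRHS]expR0 ltr_expR oppr_lt0 divr_gt0.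
(* With this tolerance the lower bound is [(1 + rho) / 2], which is larger than [rho]. *)
have [n0 hn0] := clt ((1 - rho) / 2) ltac:(lra).
(* The first term takes [n] beyond [n0]; the second makes [n] exceed s0^(-2), that is [s < s0]. *)
pose k := (n0 + (Num.trunc (s0 ^- 2)).+1)%N.
have k0 : (0 < k)%N by rewrite /k addnS.
pose n := (k * L)%N.
have kn : (k <= n)%N by rewrite /n leq_pmulr.
have nR : 0 < (n%:R : R) by rewrite ltr0n (leq_trans k0).
have := hn0 n (leq_trans (leq_addr _ _) kn).
set s := (Num.sqrt n%:R)^-1 => hlow.
have s0p : 0 < s by rewrite invr_gt0 sqrtr_gt0.
have s2 : s ^+ 2 = n%:R^-1 by rewrite exprVn sqr_sqrtr// ltW.
have ss0 : s < s0.
  rewrite -(@ltr_pXn2r _ 2) ?nnegrE ?ltW// s2 -[ltRHS]invrK ltf_pV2 ?posrE ?invr_gt0 ?exprn_gt0//.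
  apply: (lt_le_trans (truncnS_gt _)); rewrite ler_nat (leq_trans _ kn)//.
  by rewrite /k leq_addl.
have dk := hd s s0p ss0.
have hup := contraction_iter Qp N l K i0 s k 0.
have : `|\int[Q]_u cos (s * out n 0 i0 u)| <= rho.
  apply: (le_trans hup); rewrite /rho.
  have -> : - (c / L%:R) = k%:R * (- (c * s ^+ 2)).
    rewrite s2 /n natrM; field.
    by rewrite !pnatr_eq0 -!lt0n k0 L0.
  rewrite expRM_natl; apply: lerXn2r; rewrite ?nnegrE ?expR_ge0//.
    by apply: Rintegral_ge0 => z _; have /andP[] := damping_bounds N l K i0 s z.
  apply: (le_trans dk); exact: expR_ge1Dx.
move: hlow; lra.
Qed.

End Fluctuation.

(** * Powers, circuits and approximation by random products *)

Section Powers.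
Variables (R : realType) (d : nat).
Implicit Types (B C : 'M[\bar R]_d).

Lemma mp_mulr1 B : is_maxplus_op B -> mp_mul B (mp_id R d) = B.
Proof.
move=> [Bp _]; apply/matrixP => i j; apply/eqP; rewrite eq_le; apply/andP; split.
  apply/mp_mul_leP => p; rewrite mxE; case: eqP => [->|_]; first by rewrite adde0.
  by move: (Bp i p); case: (B i p) => [b||] // _; rewrite leNye.
have := (mp_mul_leP B (mp_id R d) i j _).1 (lexx _) j.
by rewrite mxE eqxx adde0.
Qed.

Definition mp_pow B k := iter k (mp_mul B) (mp_id R d).

Lemma mp_pow_op B k : is_maxplus_op B -> is_maxplus_op (mp_pow B k).
Proof.
move=> h; elim: k => [|k IH] /=; first exact: is_maxplus_op_id.
exact: is_maxplus_op_mul.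
Qed.

Lemma mp_powD B m n : mp_pow B (m + n) = mp_mul (mp_pow B m) (mp_pow B n).
Proof.
by elim: m => [|m IH]; rewrite ?mp_mul1// addSn /= IH mp_mulA.
Qed.

Local Open Scope ereal_scope.

Fixpoint walk_weight B (x : 'I_d) (s : seq 'I_d) : \bar R :=
  if s is y :: s' then B x y + walk_weight B y s' else 0.

Lemma walk_weight_cat B x s1 s2 :
  walk_weight B x (s1 ++ s2) = walk_weight B x s1 + walk_weight B (last x s1) s2.
Proof. by elim: s1 x => [|y s1 IH] x /=; rewrite ?add0e// IH addeA. Qed.

Lemma walk_weight_circuit B x s :
  \sum_(q <- mp_arcs (x :: s)) B q.1 q.2 = walk_weight B x (rcons s x).
Proof.
rewrite /mp_arcs rot1_cons.
have h z y : \sum_(q <- zip (y :: s) (rcons s z)) B q.1 q.2 = walk_weight B y (rcons s z).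
  elim: s y => [|t s IH] y; first by rewrite /= big_cons big_nil.
  by rewrite /= big_cons /= -IH.
exact: h.
Qed.

Lemma walk_weight_neq_pinfty B x s : is_maxplus_op B -> walk_weight B x s != +oo.
Proof.
move=> h; elim: s x => [|y s IH] x //=.
by apply: adde_neq_pinfty; [exact: h.1|exact: IH].
Qed.

Lemma walk_weight_le_pow B x s :
  walk_weight B x s <= mp_pow B (size s) x (last x s).
Proof.
elim: s x => [|y s IH] x /=; first by rewrite mxE eqxx.
apply: le_trans ((mp_mul_leP B (mp_pow B (size s)) x _ _).1 (lexx _) y).
exact: leeD2l.
Qed.

Lemma mp_pow_walk B n i j : is_maxplus_op B -> mp_pow B n i j != -oo ->
  exists s, [/\ size s = n, last i s = j & mp_pow B n i j = walk_weight B i s].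
Proof.
move=> h; elim: n i => [|n IH] i /=.
  have -> : mp_id R d i j = if i == j then 0 else -oo by rewrite mxE.
  by case: (eqVneq i j) => [<- _|_ /eqP]; [exists [::]|].
have [_ [p ->]] := mp_mulP i j h (mp_pow_op n h).
have [hp|hp] := eqVneq (mp_pow B n p j) -oo.
  by rewrite hp addeNy.
by move=> _; have [s [<- <- ->]] := IH p hp; exists (p :: s).
Qed.

(** The loop is cut at the last position whose node recurs: what follows it has no repetition, so
    the segment up to the next visit is elementary. *)
Lemma nonuniq_split (x : 'I_d) s : ~~ uniq (x :: s) ->
  exists s1 s2 s3, s = s1 ++ rcons s2 (last x s1) ++ s3 /\ uniq (last x s1 :: s2).
Proof.
elim: s x => [|y s IH] x //.
case: (boolP (uniq (y :: s))) => [us|nus _]; last first.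
  have [s1 [s2 [s3 [-> us]]]] := IH y nus.
  by exists (y :: s1), s2, s3.
rewrite cons_uniq us andbT negbK => xin.
case/path.splitP: xin us => p1 p2 us.
exists [::], p1, p2; split => //=.
by move: us; rewrite cat_uniq rcons_uniq => /andP[].
Qed.

(** Elementary circuits are cut out one at a time, each weighing at most [lam] times its length,
    until the walk that remains visits no node twice. *)
Lemma walk_weight_le B (lam : R) : is_maxplus_op B ->
  (forall c, elem_circuit B c -> circuit_avg B c <= lam%:E) ->
  exists K0 : R, forall x s, walk_weight B x s <= (K0 + lam * (size s)%:R)%:E.
Proof.
move=> hB hc.
have circ x s : uniq (x :: s) ->
    walk_weight B x (rcons s x) <= (lam * (size s).+1%:R)%:E.
  move=> us; rewrite -walk_weight_circuit.
  case: (boolP (all (fun q => B q.1 q.2 != -oo) (mp_arcs (x :: s)))) => [ha|].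
    have := hc (x :: s) (And3 isT us ha); rewrite /circuit_avg.
    have n0 : (0 < ((size (x :: s))%:R^-1 : R))%R by rewrite invr_gt0 ltr0n.
    have := walk_weight_neq_pinfty x (rcons s x) hB; rewrite -walk_weight_circuit.
    case: (\sum_(q <- _) _) => [r||] // _; last by move=> _; exact: leNye.
    by rewrite -EFinM !lee_fin mulrC ler_pdivrMr ?ltr0n.
  (* A closed walk using a missing arc has weight -oo, and the bound is trivial. *)
  rewrite -has_predC => /hasP [q qin /= /negPn/eqP qNy].
  rewrite (big_rem q)//= qNy addNye; exact: leNye.
have [M M0 hM] : exists2 M : R, (0 <= M)%R & forall i j, B i j <= M%:E.
  exists (\sum_i \sum_j `|fine (B i j)|)%R.
    by apply: sumr_ge0 => i _; apply: sumr_ge0.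
  move=> i j; have := hB.1 i j; case hb : (B i j) => [b||] // _; rewrite ?leNye//.
  rewrite lee_fin (bigD1 i)//= (bigD1 j)//= hb /= -addrA.
  rewrite (le_trans (ler_norm b))// lerDl addr_ge0//; first exact: sumr_ge0.
  by apply: sumr_ge0 => k _; apply: sumr_ge0.
(* [M] bounds each arc of a walk without repetition, whose length is at most [d]; [|lam|] absorbs
   [lam * size s] when [lam] is negative. *)
exists ((M + `|lam|) * d%:R)%R => x s.
have [n] := ubnP (size s); elim: n x s => // n IH x s; rewrite ltnS => sn.
case: (boolP (uniq (x :: s))) => [us|/nonuniq_split [s1 [s2 [s3 [es us]]]]].
  have sd : (size s <= d)%N.
    by have := max_card (mem (x :: s)); rewrite (card_uniqP us) card_ord => /ltnW.
  have wM z t : walk_weight B z t <= (M * (size t)%:R)%:E.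
    elim: t z => [|y t IHt] z /=; first by rewrite mulr0.
    by rewrite -natr1 mulrDr mulr1 addrC EFinD leeD.
  apply: (le_trans (wM x s)); rewrite lee_fin.
  have h1 : ((size s)%:R <= d%:R :> R)%R by rewrite ler_nat.
  have h2 : (0 <= (size s)%:R :> R)%R by rewrite ler0n.
  have := ler_norm (- lam); rewrite normrN => h3.
  have := normr_ge0 lam; nra.
have -> : walk_weight B x s =
    walk_weight B x (s1 ++ s3) + walk_weight B (last x s1) (rcons s2 (last x s1)).
  by rewrite es !walk_weight_cat last_rcons -addeA [X in _ + X]addeC.
have szE : size s = (size (s1 ++ s3) + (size s2).+1)%N.
  by rewrite es !size_cat size_rcons -addnA [(_ + size s3)%N]addnC.
have sz : (size (s1 ++ s3) < n)%N.
  by apply: leq_trans sn; rewrite szE -addn1 leq_add2l.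
apply: (le_trans (leeD (IH x _ sz) (circ _ _ us))).
by rewrite -EFinD lee_fin szE natrD mulrDr addrA.
Qed.

Lemma mp_pow_le B (lam : R) : is_maxplus_op B ->
  (forall c, elem_circuit B c -> circuit_avg B c <= lam%:E) ->
  exists K0 : R, forall n i j, mp_pow B n i j <= (K0 + lam * n%:R)%:E.
Proof.
move=> hB hc; have [K0 hK] := walk_weight_le hB hc; exists K0 => n i j.
have [->|/(mp_pow_walk hB)[s [<- _ ->]]] := eqVneq (mp_pow B n i j) -oo.
  exact: leNye.
exact: hK.
Qed.

(** Running [k] times around the circuit, of total weight [w], is a closed walk of length
    [k * size c]. *)
Lemma mp_pow_ge B c : is_maxplus_op B -> elem_circuit B c -> 0 < circuit_avg B c ->
  exists2 w : R, (0 < w)%R &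
  exists i, forall k, (w * k%:R)%:E <= mp_pow B (k * size c) i i.
Proof.
case: c => [|x s] hB [] // _ us ha.
rewrite /circuit_avg walk_weight_circuit => pos.
have := walk_weight_neq_pinfty x (rcons s x) hB.
have := walk_weight_le_pow B x (rcons s x); rewrite last_rcons size_rcons.
move: pos; set n := size (x :: s).
have n0 : (0 < (n%:R^-1 : R))%R by rewrite invr_gt0 ltr0n.
case: (walk_weight _ _ _) => [w||] //; last by rewrite gt0_muleNy// lte_fin.
rewrite -EFinM lte_fin pmulr_rgt0// => w0 hw _.
exists w => //; exists x; elim=> [|k IH]; first by rewrite mulr0 mul0n /= mxE eqxx.
rewrite mulSn mp_powD -natr1 mulrDr mulr1 addrC EFinD.
apply: le_trans ((mp_mul_leP _ _ x x _).1 (lexx _) x).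
exact: leeD.
Qed.

End Powers.

(** * Elements of T_A as limits of random products, and the sign of their circuit averages *)

Section Approximation.
Variables (R : realType) (d : nat).
Local Notation S := (seqspace R d).
Variables (Q : probability S R) (p : ('I_d -> 'I_d -> set (\bar R)) -> R).
Hypothesis Qp : forall K (B : nat -> 'I_d -> 'I_d -> set (\bar R)), finitary K B ->
  Q (cylinder B) = (\prod_(k < K) p (B k))%:E.
Implicit Types (B C : 'M[\bar R]_d).

(** The bounds are asymmetric because of the topology at -oo: there the lower bound is vacuous, and
    the upper one is an arbitrary real. *)
Definition near_event B m (e : R) (U : 'I_d -> 'I_d -> R) : set S :=
  [set u : S | forall i j, (B i j - e%:E <= prodseq u m i j)%E /\
                           (prodseq u m i j <= (U i j)%:E)%E].

(** In substance, [B] lies in the support of the law of a product of [m] operators. *)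
Definition approximable B (m : nat) : Prop := is_maxplus_op B /\
  forall (e : R) U, 0 < e -> (forall i j, (B i j < (U i j)%:E)%E) ->
  (0 < Q (near_event B m e U))%E.

Lemma measurable_near_event B m e U : measurable (near_event B m e U).
Proof.
apply: measurable_forall_fin => i; apply: measurable_forall_fin => j.
have h := @measurable_prodseq R d m i j.
apply: measurableI; rewrite -[X in measurable X]setTI.
  by apply: emeasurable_fun_c_infty.
by apply: emeasurable_fun_infty_c.
Qed.

Lemma approximable_id : approximable (mp_id R d) 0.
Proof.
split; first exact: is_maxplus_op_id.
move=> e U e0 hU; rewrite (_ : near_event _ _ _ _ = setT); last first.
  apply/seteqP; split=> // u _ i j /=; split; last exact: ltW.
  by case: (mp_id R d i j) => [r||] //=; rewrite -EFinB lee_fin gerBl ltW.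
by rewrite probability_setT.
Qed.

(** One parameter for all entries: for [b] finite or -oo, these reals decrease to [b] as [t]
    decreases to 0. *)
Definition upper (t : R) (b : \bar R) : R :=
  if b is r%:E then r + t else - t^-1.

Lemma upper_gt t b : 0 < t -> b != +oo%E -> (b < (upper t b)%:E)%E.
Proof.
by case: b => [r||] t0 // _; rewrite /upper ?ltNyr// lte_fin ltrDl.
Qed.

(** Upper semicontinuity of addition on R_max: when one term is -oo, its bound - 1/t outweighs the
    other for small [t]. *)
Lemma upper_add_le (b c : \bar R) (u : R) : b != +oo%E -> c != +oo%E ->
  (b + c < u%:E)%E -> \forall t \near 0^'+, upper t b + upper t c <= u.
Proof.
have small (r : R) : \forall t \near 0^'+, - t^-1 + r <= 0.
  have r0 : 0 < (`|r| + 1)^-1 by rewrite invr_gt0 ltr_wpDl.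
  near=> t.
  have t0 : 0 < t by near: t; exact: nbhs_right_gt.
  have : t <= (`|r| + 1)^-1 by near: t; exact: nbhs_right_le.
  rewrite -[t]invrK lef_pV2 ?posrE ?invr_gt0 ?ltr_wpDl//.
  by have := ler_norm r; rewrite invrK; lra.
case: b => [b||] //; case: c => [c||] // _ _.
- rewrite -EFinD lte_fin => h; near=> t.
  have : t <= (u - b - c) / 2 by near: t; apply: nbhs_right_le; lra.
  by rewrite /upper; lra.
- move=> _; have h := small (b + 1 - u); near=> t.
  have : - t^-1 + (b + 1 - u) <= 0 by near: t; exact: h.
  have : t <= 1 by near: t; apply: nbhs_right_le; lra.
  by rewrite /upper; lra.
- move=> _; have h := small (c + 1 - u); near=> t.
  have : - t^-1 + (c + 1 - u) <= 0 by near: t; exact: h.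
  have : t <= 1 by near: t; apply: nbhs_right_le; lra.
  by rewrite /upper; lra.
- move=> _; have h := small (- u); near=> t.
  have : - t^-1 + - u <= 0 by near: t; exact: h.
  have : 0 < t by near: t; exact: nbhs_right_gt.
  by rewrite /upper -invr_gt0; lra.
Unshelve. all: by end_near. Qed.

(** The lower bound follows one index attaining the maximum, with [e] halved between the factors;
    the upper bound must hold for all indices at once, and finitely many conditions leave a common
    [t]. The factor [C] acts first, hence the length [n + m]. *)
Lemma approximable_mul B C m n : approximable B m -> approximable C n ->
  approximable (mp_mul B C) (n + m).
Proof.
move=> [hB aB] [hC aC]; split; first exact: is_maxplus_op_mul.
move=> e U e0 hU.
have [t t0 ht] : exists2 t, 0 < t & forall i q j,
    upper t (B i q) + upper t (C q j) <= U i j.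
  have : \forall t \near (0 : R)^'+, 0 < t /\ forall i q j,
      upper t (B i q) + upper t (C q j) <= U i j.
    near=> t; split; first by near: t; exact: nbhs_right_gt.
    near: t; apply: filter_forall => i; apply: filter_forall => q.
    apply: filter_forall => j; apply: upper_add_le; [exact: hB.1|exact: hC.1|].
    apply: le_lt_trans (hU i j); exact: ((mp_mulP i j hB hC).1 q).
  by move=> /filter_ex [t [t0 ht]]; exists t.
have e20 : 0 < e / 2 by rewrite divr_gt0.
have := aC (e / 2) (fun q j => upper t (C q j)) e20 (fun q j => upper_gt t0 (hC.1 q j)).
have := aB (e / 2) (fun i q => upper t (B i q)) e20 (fun i q => upper_gt t0 (hB.1 i q)).
move=> pB pC.
apply: (splice_pos Qp (m := n) (measurable_near_event _ _ _ _) (measurable_near_event _ _ _ _)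
  (measurable_near_event _ _ _ _) _ pC pB).
move=> u v hu hv i j; rewrite prodseq_spliceD; split.
  have [_ [q ->]] := mp_mulP i j hB hC.
  apply: le_trans ((mp_mul_leP _ _ i j _).1 (lexx _) q).
  have [h1 _] := hu q j; have [h2 _] := hv i q.
  apply: le_trans (leeD h2 h1).
  have := hB.1 i q; have := hC.1 q j.
  case: (B i q) => [b||] //; case: (C q j) => [c||] //= _ _.
  by rewrite -!EFinD lee_fin; lra.
apply/mp_mul_leP => q.
have [_ h1] := hu q j; have [_ h2] := hv i q.
by apply: (le_trans (leeD h2 h1)); rewrite -EFinD lee_fin.
Unshelve. all: by end_near. Qed.

Lemma approximable_pow B m k : approximable B m -> approximable (mp_pow B k) (k * m).
Proof.
move=> aB; elim: k => [|k IH]; first exact: approximable_id.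
by rewrite mulSnr /=; exact: approximable_mul.
Qed.

Variables (N : nat) (K : R) (i0 : 'I_d).
Hypothesis N0 : (0 < N)%N.
Hypothesis clt0 : forall e : R, 0 < e -> exists n0 : nat, forall n, (n0 <= n)%N ->
  1 - e <= `|\int[Q]_u cos ((Num.sqrt n%:R)^-1 * out n 0 i0 u)|.
Hypothesis rank1_pos : (0 < Q [set u : S | rank1_bounded K (prodseq u N)])%E.
Hypothesis lyapunov : forall (e : R) (M k0 : nat), 0 < e -> (0 < M)%N ->
  exists2 k, (k0 <= k)%N &
    (0 < Q [set u : S | forall i, (`|out (k * M) 0 i u| <= e * k%:R)%R])%E.

Let measurable_out_lo n (a : R) : measurable [set u : S | forall i, out n 0 i u <= a].
Proof.
apply: measurable_forall_fin => i; rewrite -[X in measurable X]setTI.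
by apply: measurable_fun_le => //; exact: measurable_out.
Qed.

Let measurable_out_hi n (b : R) : measurable [set u : S | exists i, b <= out n 0 i u].
Proof.
apply: measurable_exists_fin => i; rewrite -[X in measurable X]setTI.
by apply: measurable_fun_le => //; exact: measurable_out.
Qed.

Let measurable_out_abs n (b : R) : measurable [set u : S | forall i, `|out n 0 i u| <= b].
Proof.
apply: measurable_forall_fin => i; rewrite -[X in measurable X]setTI.
by apply: measurable_fun_le => //; apply: measurableT_comp => //; exact: measurable_out.
Qed.

(** At the same time, random products close to a power of [B] reach height about [w * k], while the
    Lyapunov exponent gives products staying below [w / 2 * k]. *)
Lemma approximable_rho_le0 B m : (0 < m)%N -> approximable B m ->
  (rho_max B <= 0)%E.
Proof.
move=> m0 aB; rewrite leNgt; apply/negP => rpos.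
have [c ec cpos] : exists2 c, elem_circuit B c & (0 < circuit_avg B c)%E.
  apply: contrapT => no; move: rpos; apply/negP; rewrite -leNgt.
  apply: ge_ereal_sup => _ [c ec <-]; rewrite leNgt; apply/negP => cp.
  by apply: no; exists c.
have [w w0 [i hw]] := mp_pow_ge aB.1 ec cpos.
have sc : (0 < size c)%N by case: c ec {cpos hw} => [|//] [].
(* The gap must be [4 * K + 1]; one more unit pays for the tolerance 1 in the approximation of the
   power. *)
pose k0 := (Num.trunc ((4 * K + 2) / (w / 2))).+1.
have [k kk0 lo] := lyapunov k0 (divr_gt0 w0 (ltr0Sn R 1)) (M := (size c * m)%N)
  ltac:(by rewrite muln_gt0 sc).
have kK : 4 * K + 2 <= w / 2 * k%:R.
  rewrite [leRHS]mulrC -ler_pdivrMr ?divr_gt0//.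
  by apply: (le_trans (ltW (truncnS_gt _))); rewrite ler_nat.
have [opk ak] := approximable_pow (k * size c) aB.
have := ak 1 (fun i j => upper 1 (mp_pow B (k * size c) i j)) ltr01
  (fun i j => upper_gt ltr01 (opk.1 i j)).
rewrite -mulnA => near.
apply: (fluctuation_contra (a := w / 2 * k%:R) (b := w * k%:R - 1) Qp
  (l := (k * (size c * m))%N) N0 clt0 rank1_pos); last by lra.
- apply: (lt_le_trans lo); apply: le_measure; rewrite ?inE//.
  by move=> u h j; exact: le_trans (ler_norm _) (h j).
- apply: (lt_le_trans near); apply: le_measure; rewrite ?inE//.
    exact: measurable_near_event.
  move=> u /(_ i i) [h _]; exists i.
  have := mp_apply_ge 0 i i (prodseq_op u (k * (size c * m))).
  rewrite mxE adde0 -lee_fin; apply: le_trans; apply: le_trans h.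
  by rewrite EFinB leeB.
Qed.

(** The roles are exchanged: powers of [B] supply the low event, falling at slope [lam], and the
    Lyapunov exponent the high one, above slope [lam / 2]. *)
Lemma approximable_rho_ge0 B m : (0 < m)%N -> approximable B m ->
  (0 <= rho_max B)%E.
Proof.
move=> m0 aB; rewrite leNgt; apply/negP => rneg.
have [lam lam0 hlam] : exists2 lam : R, lam < 0 & (rho_max B <= lam%:E)%E.
  case: (rho_max B) rneg => [r||] //; first by rewrite lte_fin; exists r.
  (* When [rho_max B] is -oo, any negative real serves as [lam]. *)
  by move=> _; exists (-1); rewrite ?leNye// oppr_lt0.
have [K0 hK0] := mp_pow_le (lam := lam) aB.1 (fun c ec =>
  le_trans (ereal_sup_ubound (ex_intro2 _ _ c ec erefl)) hlam).
have l2 : 0 < - lam / 2 by rewrite divr_gt0// oppr_gt0.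
pose k0 := (Num.trunc ((4 * K + K0 + 2) / (- lam / 2))).+1.
have [k kk0 lo] := lyapunov k0 l2 (M := m) m0.
have kK : 4 * K + K0 + 2 <= - lam / 2 * k%:R.
  rewrite [leRHS]mulrC -ler_pdivrMr//.
  by apply: (le_trans (ltW (truncnS_gt _))); rewrite ler_nat.
have [opk ak] := approximable_pow k aB.
pose U := K0 + lam * k%:R + 1.
have hU i j : (mp_pow B k i j < U%:E)%E.
  by apply: (le_lt_trans (hK0 k i j)); rewrite lte_fin /U ltrDl.
have near := ak 1 (fun _ _ => U) ltr01 hU.
apply: (fluctuation_contra (a := U) (b := - (- lam / 2 * k%:R)) Qp
  (l := (k * m)%N) N0 clt0 rank1_pos); last by rewrite /U; lra.
- apply: (lt_le_trans near); apply: le_measure; rewrite ?inE//.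
    exact: measurable_near_event.
  move=> u h i.
  have [j [r [hr e]]] := mp_apply_ex 0 i (prodseq_op u (k * m)).
  rewrite /out e mxE addr0 -lee_fin -hr; exact: (h i j).2.
- apply: (lt_le_trans lo); apply: le_measure; rewrite ?inE//.
  by move=> u h; exists i0; have := h i0; rewrite ler_norml => /andP[].
Qed.

End Approximation.

(** * The law of the driving sequence *)

Section ExtendedBasis.
Variable R : realType.

(** A countable base of R_max, with rational endpoints; [None] gives the neighbourhoods of -oo. The
    point +oo is left out, as no operator has it as an entry. *)
Definition basic_nbhs (e : option rat * rat) : set (\bar R) :=
  match e with
  | (Some a, b) => [set y | ((ratr a)%:E < y)%E /\ (y < (ratr b)%:E)%E]
  | (None, b) => [set y | (y < (ratr b)%:E)%E]
  end.

Lemma basic_nbhsP (U : set (\bar R)) (b : \bar R) : open U -> U b -> b != +oo%E ->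
  exists e, basic_nbhs e b /\ basic_nbhs e `<=` U.
Proof.
rewrite openE => oU Ub; have := oU b Ub; case: b {Ub} => [b||] // nb _.
  have [/= e e0 he] : nbhs b [set r : R | U r%:E] by exact: nb.
  have [q1 /[!in_itv]/= /andP[l1 r1]] := @rat_in_itvoo R (b - e) b ltac:(lra).
  have [q2 /[!in_itv]/= /andP[l2 r2]] := @rat_in_itvoo R b (b + e) ltac:(lra).
  exists (Some q1, q2); split=> [|[y||]]/=; rewrite ?lte_fin.
  - by split.
  - move=> [h1 h2]; apply: he; rewrite /ball_ /= ltr_norml; apply/andP; split; lra.
  - by case.
  - by case.
have [M [_ hM]] : ereal_nbhs -oo%E U by exact: nb.
have [q /[!in_itv]/= /andP[l1 r1]] := @rat_in_itvoo R (M - 1) M ltac:(lra).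
exists (None, q); split=> /= [|y hy]; first exact: ltNyr.
by apply: hM; apply: (lt_trans hy); rewrite lte_fin.
Qed.

Lemma measurable_basic_nbhs e : measurable (basic_nbhs e).
Proof.
case: e => [[a|] b] /=; last first.
  by rewrite -[X in measurable X]setTI; apply: emeasurable_fun_infty_o => //; exact: measurable_id.
apply: measurableI; rewrite -[X in measurable X]setTI.
  by apply: emeasurable_fun_o_infty => //; exact: measurable_id.
by apply: emeasurable_fun_infty_o => //; exact: measurable_id.
Qed.

(** The basic sets contained in [U] are countably many and cover all of it except possibly +oo,
    which is added separately. *)
Lemma open_emeasurable (U : set (\bar R)) : open U -> measurable U.
Proof.
move=> oU.
pose F k : set (\bar R) := if @unpickle (option rat * rat)%type k is Some e then
  [set y | basic_nbhs e y /\ basic_nbhs e `<=` U] else set0.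
have mF k : measurable (F k).
  rewrite /F; case: unpickle => [e|]//.
  have [s|s] := pselect (basic_nbhs e `<=` U).
    rewrite (_ : [set y | _] = basic_nbhs e); first exact: measurable_basic_nbhs.
    by apply/seteqP; split=> y // [].
  rewrite (_ : [set y | _] = set0)//.
  by apply/seteqP; split=> y // [].
have [Uy|Uy] := pselect (U +oo%E).
  rewrite (_ : U = \bigcup_k F k `|` [set +oo%E]).
    by apply: measurableU => //; exact: bigcupT_measurable.
  apply/seteqP; split=> y; last first.
    move=> [[k _]|-> //]; rewrite /F; case: unpickle => // e [h1 h2]; exact: h2.
  have [->|yy uy] := eqVneq y +oo%E; first by right.
  left; have [e [h1 h2]] := basic_nbhsP oU uy yy.
  by exists (pickle e) => //; rewrite /F pickleK.
rewrite (_ : U = \bigcup_k F k); first exact: bigcupT_measurable.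
apply/seteqP; split=> y; last first.
  move=> [k _]; rewrite /F; case: unpickle => // e [h1 h2]; exact: h2.
have [->//|yy uy] := eqVneq y +oo%E.
have [e [h1 h2]] := basic_nbhsP oU uy yy.
by exists (pickle e) => //; rewrite /F pickleK.
Qed.

End ExtendedBasis.

Lemma ae_exists d0 (T : measurableType d0) (R : realType) (P : probability T R)
  (D : T -> Prop) : {ae P, forall w, D w} -> exists w, D w.
Proof.
move=> h; apply: contrapT => /forallNP no.
have : P.-negligible setT by apply: negligibleS h => w _; exact: no.
move/negligibleP => /(_ measurableT) e0.
have e1 : P setT = 1%E by rewrite probability_setT.
by move: (etrans (esym e1) e0) => /eqP; rewrite onee_eq0.
Qed.

(** * From the given probability space to the law on sequences *)

Section Transfer.
Variables (R : realType) (d : nat) (d0 : measure_display) (T : measurableType d0).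
Variables (P : probability T R) (A : nat -> T -> 'M[\bar R]_d).
Hypothesis iidA : iid_maxplus P A.
Local Notation S := (seqspace R d).

Let Aop n w : is_maxplus_op (A n.+1 w).
Proof. by case: iidA => h _ _ _; exact: h. Qed.

(** The shift discards [A 0], about which [iid_maxplus] says nothing. *)
Definition traj (w : T) : S := @OpSeq R d (fun k => A k.+1 w) (fun k => Aop k w).

Lemma mp_prod_path n w : mp_prod A n w = prodseq (traj w) n.
Proof. by elim: n => //= n ->. Qed.

Lemma mp_orbit_path X0 n w : mp_orbit A X0 n w = mp_apply (prodseq (traj w) n) (X0 w).
Proof.
elim: n => [|n IH]; first by rewrite /= mp_apply_id.
by rewrite /= IH mp_apply_mul//; exact: (prodseq_op (traj w)).
Qed.

Lemma measurable_mx_event n B : (forall i j, measurable (B i j)) ->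
  measurable (mx_event (A n.+1) B).
Proof.
move=> mB; case: iidA => _ mA _ _.
apply: measurable_forall_fin => i; apply: measurable_forall_fin => j.
rewrite -[X in measurable X]setTI; exact: (mA n.+1 i j).
Qed.

Lemma path_preimage K (B : nat -> 'I_d -> 'I_d -> set (\bar R)) : finitary K B ->
  traj @^-1` cylinder B =
  \bigcap_(n in [set` iota 1 K]) mx_event (A n) (B n.-1).
Proof.
move=> [mB BT]; apply/seteqP; split=> w /=.
  move=> h [|n] /=; first by rewrite mem_iota.
  by move=> _ i j; exact: h.
move=> h n i j; case: (ltnP n K) => nK; last by rewrite BT.
by apply: (h n.+1); rewrite /= mem_iota /= add1n ltnS.
Qed.

Lemma measurable_path : measurable_fun setT traj.
Proof.
apply: measurable_to_seqspace => K B fB; rewrite (path_preimage fB).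
apply: fin_bigcap_measurable => // -[|n] /=; first by rewrite mem_iota.
by move=> _; apply: measurable_mx_event; exact: fB.1.
Qed.

HB.instance Definition _ := isMeasurableFun.Build _ _ _ _ traj measurable_path.

Definition path_law : probability S R := distribution P traj.

Lemma path_lawE E : path_law E = P (traj @^-1` E).
Proof. by []. Qed.

Lemma path_law_cylinder K (B : nat -> 'I_d -> 'I_d -> set (\bar R)) : finitary K B ->
  path_law (cylinder B) = (\prod_(k < K) fine (P (mx_event (A 1%N) (B k))))%:E.
Proof.
move=> fB; rewrite path_lawE -[LHS]fineK; last first.
  apply: fin_num_measure; rewrite -[X in measurable X]setTI.
  exact: measurable_path (measurable_cylinder fB).
congr EFin; rewrite (path_preimage fB); case: iidA => _ _ idd ind.
rewrite ind ?iota_uniq//; last 2 first.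
- by apply/allP => n; rewrite mem_iota => /andP[].
- by move=> n; exact: fB.1.
rewrite -[RHS](big_mkord xpredT (fun k => fine (P (mx_event (A 1%N) (B k))))).
rewrite (_ : iota 1 K = map succn (iota 0 K)) ?big_map; last by rewrite -[1%N]addn0 iotaDl.
rewrite /index_iota subn0 [in RHS]big_seq [in LHS]big_seq; apply: eq_bigr => n _ /=.
congr fine; apply: idd => // i j; exact: fB.1.
Qed.

Lemma ae_mx_event_null n (B : 'I_d -> 'I_d -> set (\bar R)) :
  (forall i j, measurable (B i j)) -> P (mx_event (A 1%N) B) = 0%E ->
  P.-negligible (mx_event (A n.+1) B).
Proof.
move=> mB B0; apply/negligibleP; first exact: measurable_mx_event.
by rewrite -B0; case: iidA => _ _ idd _; apply: idd.
Qed.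

(** An operator outside the support lies in a null open box, hence in a null box with sides in the
    countable base; there are countably many of these. *)
Lemma ae_support : {ae P, forall w, forall n, mp_support P A (A n.+1 w)}.
Proof.
apply: ae_foralln => n.
pose rect (e : {ffun 'I_d * 'I_d -> option rat * rat}) i j := @basic_nbhs R (e (i, j)).
pose F k : set T := if @unpickle {ffun 'I_d * 'I_d -> option rat * rat} k is Some e then
  (if P (mx_event (A 1%N) (rect e)) == 0%E then mx_event (A n.+1) (rect e) else set0)
  else set0.
apply: (@negligibleS _ _ _ _ (\bigcup_k F k)); last first.
  apply: negligible_bigcup => k; rewrite /F; case: unpickle => [e|]; last exact: negligible_set0.
  case: eqP => [e0|_]; last exact: negligible_set0.
  by apply: ae_mx_event_null => // i j; exact: measurable_basic_nbhs.
move=> w /= nsupp.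
have [U [oU U0]] : exists U : 'I_d -> 'I_d -> set (\bar R),
    (forall i j, open (U i j) /\ U i j (A n.+1 w i j)) /\
    P (mx_event (A 1%N) U) = 0%E.
  apply: contrapT => no; apply: nsupp; split=> // U oU.
  rewrite lt0e measure_ge0 andbT; apply/eqP => U0; apply: no.
  by exists U.
have /choice[e he] : forall q : 'I_d * 'I_d, exists e,
    basic_nbhs e (A n.+1 w q.1 q.2) /\ @basic_nbhs R e `<=` U q.1 q.2.
  move=> q; have [h1 h2] := oU q.1 q.2.
  by apply: basic_nbhsP => //; exact: (Aop n w).1.
exists (pickle [ffun q => e q]) => //; rewrite /F pickleK.
have mr i j : measurable (rect [ffun q => e q] i j) by exact: measurable_basic_nbhs.
rewrite (_ : _ == _ = true).
  by move=> i j; rewrite /rect ffunE; exact: (he (i, j)).1.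
apply/eqP; apply/eqP; rewrite eq_le measure_ge0 andbT -U0.
apply: le_measure; rewrite ?inE.
- exact: measurable_mx_event.
- by apply: measurable_mx_event => i j; apply: open_emeasurable; have [] := oU i j.
- by move=> v h i j; apply: (he (i, j)).2; have := h i j; rewrite /rect ffunE.
Qed.

(** The support condition is applied to an open box inside the bounds, without a lower side where
    [B] is -oo. *)
Lemma support_approximable B : mp_support P A B -> approximable path_law B 1.
Proof.
move=> [hB supp]; split=> // e U e0 hU.
pose V i j : set (\bar R) := [set y | (if B i j == -oo%E then True else (B i j - e%:E < y)%E)]
  `&` [set y | (y < (U i j)%:E)%E].
have oV i j : open (V i j).
  apply: openI; last exact: open_ereal_lt_ereal.
  case: eqP => _; last exact: open_ereal_gt_ereal.
  by rewrite (_ : [set _ | True] = setT); [exact: openT|apply/seteqP; split].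
have := supp V; move/(_ (fun i j => conj (oV i j) _)) => h.
have {}h : (0 < P (mx_event (A 1%N) V))%E.
  apply: h => i j; split; last exact: hU.
  rewrite /=; case: eqP => // bNy; have := hB.1 i j.
  by case: (B i j) bNy => [b||] // _ _; rewrite -EFinB lte_fin gtrBl.
apply: (lt_le_trans h); rewrite path_lawE; apply: le_measure; rewrite ?inE.
- by apply: measurable_mx_event => i j; exact: open_emeasurable.
- rewrite -[X in measurable X]setTI; apply: measurable_path => //.
  exact: measurable_near_event.
- move=> w hw i j; rewrite /= mp_mulr1; last exact: Aop.
  have [/= h1 h2] := hw i j; split; last exact: ltW.
  by move: h1; case: eqP => [->|_ /ltW]// _; rewrite /= leNye.
Qed.

Lemma semigroup_approximable B : mp_semigroup (mp_support P A) B ->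
  exists2 m, (0 < m)%N & approximable path_law B m.
Proof.
elim=> [{}B /support_approximable h|{}B C _ [m m0 hB] _ [n n0 hC]]; first by exists 1%N.
exists (n + m)%N; first by rewrite addn_gt0 n0.
exact: (approximable_mul (p := fun V => fine (P (mx_event (A 1%N) V))) path_law_cylinder hB hC).
Qed.

(** At least one factor is required: the empty product is the identity, which need not belong to
    T_A. *)
Lemma prodseq_semigroup w n : (forall k, mp_support P A (A k.+1 w)) ->
  mp_semigroup (mp_support P A) (prodseq (traj w) n.+1).
Proof.
move=> h; elim: n => [|n IH].
  by rewrite /= mp_mulr1; [apply: mp_sg_base; exact: h|exact: Aop].
by rewrite /=; apply: mp_sg_mul IH; apply: mp_sg_base; exact: h.
Qed.

End Transfer.

Lemma measurable_bigmine (R : realType) d0 (T : measurableType d0) (I : finType)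
  (F : I -> T -> \bar R) : (forall i, measurable_fun setT (F i)) ->
  measurable_fun setT (fun t => \big[mine/+oo%E]_i F i t).
Proof.
move=> mF.
have h (s : seq I) : measurable_fun setT (fun t => \big[mine/+oo%E]_(i <- s) F i t).
  elim: s => [|i s IH].
    by under eq_fun do rewrite big_nil; exact: measurable_cst.
  by under eq_fun do rewrite big_cons; apply: measurable_mine.
exact: (h (index_enum I)).
Qed.

Lemma prodseq_columns (R : realType) (d : nat) (u : seqspace R d) n j :
  (forall k j, exists i, u k i j != -oo%E) -> exists i, prodseq u n i j != -oo%E.
Proof.
move=> h; elim: n j => [|n IH] j; first by exists j; rewrite mxE eqxx.
have [q hq] := IH j; have [i hi] := h n q; exists i => /=.
have := (mp_mulP i j (opseqP u n) (prodseq_op u n)).1 q.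
move: hi hq (opseqP u n).1 (prodseq_op u n).1 => hi hq /(_ i q) + /(_ q j).
move: hi hq; case: (u n i q) => [a||] // _; case: (prodseq u n q j) => [b||] // _ _ _.
by case: (mp_mul _ _ i j).
Qed.

(** * Consequences of the moment, memory loss, Lyapunov and limit hypotheses *)

Section Hypotheses.
Variables (R : realType) (d : nat) (d0 : measure_display) (T : measurableType d0).
Variables (P : probability T R) (A : nat -> T -> 'M[\bar R]_d).
Hypothesis iidA : iid_maxplus P A.
Local Notation S := (seqspace R d).
Local Notation Q := (path_law iidA).
Local Notation traj := (traj iidA).

Let measurable_preimage (E : set S) : measurable E -> measurable (traj @^-1` E).
Proof.
by move=> mE; rewrite -[X in measurable X]setTI; exact: (measurable_path iidA).
Qed.

(** A column equal to -oo makes the minimum of column maxima -oo and its square +oo, which an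
    integrable function avoids almost surely. Equality of laws carries this from A(1) to all
    times. *)
Lemma ae_columns :
  (\int[P]_w ((\big[mine/+oo]_j \big[maxe/-oo]_i A 1%N w i j) *
              (\big[mine/+oo]_j \big[maxe/-oo]_i A 1%N w i j)) < +oo)%E ->
  {ae P, forall w, forall k j, exists i, A k.+1 w i j != -oo%E}.
Proof.
move=> hint.
pose m w : \bar R := (\big[mine/+oo]_j \big[maxe/-oo]_i A 1%N w i j)%E.
have mA i j : measurable_fun setT (fun w => A 1%N w i j).
  by case: iidA => _ h _ _; exact: h.
have mm : measurable_fun setT m.
  by apply: measurable_bigmine => j; apply: measurable_bigmaxe => i.
have imm : P.-integrable setT (fun w => m w * m w)%E.
  apply/integrableP; split; first exact: emeasurable_funM.
  apply: le_lt_trans hint; rewrite le_eqVlt; apply/orP; left; apply/eqP.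
  apply: eq_integral => w _; apply: gee0_abs; rewrite -/(m w).
  case: (m w) => [r||]; first by rewrite -EFinM lee_fin -expr2 sqr_ge0.
    by rewrite mulyy.
  by rewrite mulNyNy.
have fm : {ae P, forall w, setT w -> (m w * m w)%E \is a fin_num}.
  exact: (integrable_ae measurableT imm).
pose B (j i j' : 'I_d) : set (\bar R) := if j' == j then [set -oo%E] else setT.
have mB j i j' : measurable (B j i j') by rewrite /B; case: ifP.
have B0 j : P (mx_event (A 1%N) (B j)) = 0%E.
  apply/negligibleP; first exact: (measurable_mx_event iidA 0).
  apply: negligibleS fm => w hw /= /(_ I).
  suff -> : m w = -oo%E by rewrite mulNyNy.
  apply/eqP; rewrite -leeNy_eq.
  apply: (@le_trans _ _ (\big[maxe/-oo%E]_i A 1%N w i j)).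
    exact: (@bigmin_le _ _ _ +oo%E j (fun j => \big[maxe/-oo%E]_i A 1%N w i j)).
  apply/bigmaxe_leP => i; have := hw i j; rewrite /B eqxx /= => ->; exact: lexx.
apply: ae_foralln => k; apply: filter_forall => j.
apply: negligibleS (ae_mx_event_null iidA k (mB j) (B0 j)) => w /= /forallNP h i j'.
rewrite /B; case: eqP => [->|//] /=.
by apply/eqP; apply: contrapT => /negP; exact: h.
Qed.

(** In a rank 1 operator, a column with one finite entry is finite throughout. Since no column of
    the product is -oo, almost every rank 1 realization has a finite entry bound, and some integer
    bound has positive probability. *)
Lemma memory_loss_rank1_bounded : memory_loss P A ->
  {ae P, forall w, forall k j, exists i, A k.+1 w i j != -oo%E} ->
  exists N (K : R), (0 < N)%N /\
    (0 < Q [set u : S | rank1_bounded K (prodseq u N)])%E.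
Proof.
move=> [N [N0 hP]] hcol.
pose F (K : nat) : set S := [set u : S | rank1_bounded K%:R (prodseq u N)].
have mF K : measurable (F K) by exact: measurable_rank1_bounded.
pose E : set S := [set u : S | forall i k j,
  (prodseq u N i j + rowmax (prodseq u N) k =
   prodseq u N k j + rowmax (prodseq u N) i)%E].
have EP : [set w | mp_rank1 (mp_prod A N w)] = traj @^-1` E.
  apply/seteqP; split=> w /=; rewrite (mp_prod_path iidA);
  by move/(mp_rank1P (prodseq_op (traj w) N)).
suff [K hK] : exists K, (0 < Q (F K))%E by exists N, K%:R.
apply: bigcup_pos => //; rewrite lt0e measure_ge0 andbT; apply/eqP => F0.
move: hP; rewrite EP lt0e => /andP[/eqP + _]; apply.
apply/negligibleP; first by apply: measurable_preimage; exact: measurable_rank1_eq.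
have nF : P.-negligible (traj @^-1` (\bigcup_K F K)).
  apply/negligibleP; last exact: F0.
  by apply: measurable_preimage; exact: bigcupT_measurable.
apply: negligibleS (negligibleU hcol nF) => w Ew.
have [wcol|] := pselect (forall k j, exists i, A k.+1 w i j != -oo%E); last by left.
right; set M := prodseq (traj w) N.
have opM : is_maxplus_op M by exact: prodseq_op.
have fM i j : exists r : R, M i j = r%:E.
  have [k hk] := @prodseq_columns _ _ (traj w) N j wcol.
  have := Ew i k j; rewrite !rowmaxE//; have := opM.1 k j; have := opM.1 i j.
  rewrite -/M; move: hk; rewrite -/M.
  by case: (M k j) => [a||] //; case: (M i j) => [b||] // _ _ _ _; exists b.
exists (Num.trunc (\sum_i \sum_j `|fine (M i j)|)).+1 => //; split=> //.
move=> i j; have [r hr] := fM i j.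
rewrite -/M hr !lee_fin; apply/andP; rewrite -ler_norml.
apply: le_trans (ltW (truncnS_gt _)).
rewrite (bigD1 i)//= (bigD1 j)//= hr /= -addrA lerDl addr_ge0//.
  exact: sumr_ge0.
by apply: sumr_ge0 => k _; apply: sumr_ge0.
Qed.

(** If every [k >= k0] failed, almost no trajectory would meet any of these events, against almost
    sure convergence along the multiples of [M], taken with tolerance [e / M]. *)
Lemma lyapunov_small :
  {ae P, forall w, forall i : 'I_d,
     (fun n : nat => mp_orbit A (fun _ => 0) n w 0 i / n%:R) @ \oo --> (0 : R)} ->
  forall (e : R) (M k0 : nat), 0 < e -> (0 < M)%N -> exists2 k, (k0 <= k)%N &
    (0 < Q [set u : S | forall i, (`|out (k * M) 0 i u| <= e * k%:R)%R])%E.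
Proof.
move=> hlyap e M k0 e0 M0.
pose E k : set S := [set u : S | forall i, `|out (k * M) 0 i u| <= e * k%:R].
have mE k : measurable (E k).
  apply: measurable_forall_fin => i; rewrite -[X in measurable X]setTI.
  by apply: measurable_fun_le => //; apply: measurableT_comp => //; exact: measurable_out.
apply: contrapT => no.
have null k : {ae P, forall w, (k0 <= k)%N -> ~ E k (traj w)}.
  have [kk|kk] := leqP k0 k; last by apply: aeW => w.
  apply: (@negligibleS _ _ _ _ (traj @^-1` E k)).
    by move=> w /= h; apply: contrapT => h'; apply: h.
  apply/negligibleP; first exact: measurable_preimage.
  apply/eqP; rewrite eq_le measure_ge0 andbT leNgt; apply/negP => h.
  by apply: no; exists k.
have := ae_foralln null => null'.
have [w [lw nw]] : exists w,
   (forall i : 'I_d, (fun n : nat => mp_orbit A (fun _ => 0) n w 0 i / n%:R) @ \oo --> (0 : R))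
   /\ (forall k, (k0 <= k)%N -> ~ E k (traj w)).
  by apply: (@ae_exists _ _ _ P); apply: filterI.
have eM : 0 < e / M%:R by rewrite divr_gt0// ltr0n.
have : \forall n \near \oo, forall i : 'I_d,
    `|0 - mp_orbit A (fun _ => 0) n w 0 i / n%:R| < e / M%:R.
  by apply: filter_forall => i; move/cvgrPdist_lt : (lw i); exact.
move=> [n0 _ hn0].
pose k := maxn k0 (maxn n0 1).
have k1 : (0 < k)%N by rewrite /k !leq_max !orbT.
apply: (nw k); first by rewrite leq_maxl.
have kM : (n0 <= k * M)%N.
  by rewrite (@leq_trans k)//; [rewrite /k !leq_max leqnn orbT|rewrite leq_pmulr].
move=> i; have := hn0 _ kM i.
rewrite sub0r normrN (mp_orbit_path iidA) normrM normfV -/(out (k * M) 0 i (traj w)).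
rewrite [`|(k * M)%:R|]ger0_norm// ltr_pdivrMr ?ltr0n ?muln_gt0 ?k1//.
rewrite natrM mulrCA divfK ?pnatr_eq0 -?lt0n// mulrC => /ltW.
by [].
Qed.

Lemma indep_init_cst (x : 'rV[R]_d) : indep_init P A (fun=> x).
Proof.
split=> [k|C s B _ _ _]; first exact: measurable_cst.
have [h|h] := pselect (forall k, C k (x 0 k)).
  rewrite (_ : rv_event _ _ = setT); last by apply/seteqP; split.
  by rewrite setTI probability_setT mul1r.
rewrite (_ : rv_event _ _ = set0); last by apply/seteqP; split.
by rewrite set0I measure0 mul0r.
Qed.

(** The test function is 1 - cos rather than cos: it vanishes at 0, so its degenerate Gaussian
    expectation is 0 without computing the mass of the density. *)
Lemma clt_degenerate_cos (i0 : 'I_d) : clt_holds P A (fun=> 0) 0 ->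
  forall e : R, 0 < e -> exists n0 : nat, forall n, (n0 <= n)%N ->
    1 - e <= `|\int[Q]_u cos ((Num.sqrt n%:R)^-1 * out n 0 i0 u)|.
Proof.
move=> clt e e0.
pose f (x : 'rV[R]_d) : R := 1 - cos (x 0 i0).
have cf : continuous f.
  move=> x.
  have h : {for x, continuous (fun y : 'rV[R]_d => cos (y 0 i0))}.
    apply: (@continuous_comp _ _ _ (fun y : 'rV[R]_d => y 0 i0) (@cos R)).
      exact: (@coord_continuous R 1 d 0 i0).
    exact: continuous_cos.
  exact: (@cvgB R R^o _ (nbhs x) _ (fun=> 1) _ 1 (cos (x 0 i0)) (cvg_cst _) h).
have bf : exists M : R, forall x, `|f x| <= M.
  exists 2 => x; rewrite /f (le_trans (ler_normB _ _))// normr1.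
  by rewrite [leRHS](_ : 2 = 1 + 1)// lerD2l norm_cos_le1.
have := clt f cf bf; rewrite /gauss_diag_expect.
have -> : (\int[@lebesgue_measure R]_g
    ((f (const_mx (Num.sqrt 0 * g))) * std_gauss_pdf g)%:E = 0)%E.
  rewrite -[RHS](integral0 (@lebesgue_measure R) setT); apply: eq_integral => g _ /=.
  by rewrite sqrtr0 mul0r /f mxE cos0 subrr mul0r.
pose s (n : nat) : R := (Num.sqrt n%:R)^-1.
pose c n : R := \int[Q]_u cos (s n * out n 0 i0 u).
have P1 : (P setT < +oo)%E by rewrite probability_setT ltry.
have E n : (\int[P]_w (f ((Num.sqrt n%:R)^-1 *: mp_orbit A (fun=> 0%R) n w))%:E)%E = (1 - c n)%:E.
  have mg : measurable_fun setT (fun u : S => 1 - cos (s n * out n 0 i0 u)).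
    by apply: measurable_funB => //; exact: measurable_cos_out.
  have ic : Q.-integrable setT (EFin \o (fun u : S => cos (s n * out n 0 i0 u))).
    exact: integrable_cos_out.
  have i1 : Q.-integrable setT (EFin \o (fun=> 1 : R)).
    by apply: (bounded_integrable (Q_lty Q) (M := 1)) => // w; rewrite normr1.
  have ig : Q.-integrable setT (EFin \o (fun u : S => 1 - cos (s n * out n 0 i0 u))).
    by have := integrableB measurableT i1 ic; apply: eq_integrable => // u _ /=; rewrite EFinB.
  have -> : 1 - c n = \int[Q]_u (1 - cos (s n * out n 0 i0 u)).
    rewrite RintegralB//; congr (_ - _).
    have e1 : fine (Q setT) = 1 by rewrite probability_setT.
    by rewrite Rintegral_cst// [X in _ * X]e1 mulr1.
  rewrite /Rintegral fineK; last exact: integrable_fin_num ig.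
  rewrite integral_distribution/=.
  - by apply: eq_integral => w _; rewrite /f mxE (mp_orbit_path iidA).
  - exact/measurable_EFinP.
  - apply: (bounded_integrable (M := 2)) => [||w].
    + exact: P1.
    + exact: measurableT_comp mg (measurable_path iidA).
    + rewrite /= (le_trans (ler_normB _ _))// normr1.
      by rewrite [leRHS](_ : 2 = 1 + 1)// lerD2l norm_cos_le1.
under eq_fun do rewrite E.
move=> /fine_cvgP[_] /= /cvgrPdist_lt /(_ _ e0) [n0 _ hn0].
exists n0 => n nn0; have := hn0 n nn0; rewrite /= sub0r normrN => h.
have := ler_norm (c n); have := ler_norm (1 - c n); rewrite -/(c n) /c /s; lra.
Qed.

End Hypotheses.

(** * The converse implication *)

Section Converse.
Variables (R : realType) (d : nat).

(** Every entry is at most the value of its row at 0. As [rho_max] is a supremum, strictness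
    requires one [e] common to all rows. *)
Lemma rho_max_lt0 (M : 'M[\bar R]_d) : is_maxplus_op M ->
  (forall i, mp_apply M 0 0 i < 0) -> (rho_max M < 0)%E.
Proof.
move=> h neg.
have [e e0 he] : exists2 e : R, 0 < e & forall i, mp_apply M 0 0 i <= - e.
  have : \forall e \near (0 : R)^'+, 0 < e /\ forall i, mp_apply M 0 0 i <= - e.
    near=> e; split; first by near: e; exact: nbhs_right_gt.
    near: e; apply: filter_forall => i; near=> e; rewrite lerNr.
    by near: e; apply: nbhs_right_le; rewrite oppr_gt0.
  by move=> /filter_ex [e [e0 he]]; exists e.
apply: (@le_lt_trans _ _ (- e)%:E); last by rewrite lte_fin oppr_lt0.
apply: ge_ereal_sup => _ [c [c0 uc ac] <-].
have sle (s : seq ('I_d * 'I_d)) : (\sum_(q <- s) M q.1 q.2 <= (- e * (size s)%:R)%:E)%E.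
  elim: s => [|q s IH]; first by rewrite big_nil mulr0.
  rewrite big_cons /= -natr1 mulrDr mulr1 addrC EFinD leeD//.
  apply: (@le_trans _ _ (mp_apply M 0 0 q.1)%:E); last by rewrite lee_fin.
  by have := mp_apply_ge 0 q.1 q.2 h; rewrite mxE adde0.
have := sle (mp_arcs c); rewrite /circuit_avg.
have -> : size (mp_arcs c) = size c by rewrite /mp_arcs size1_zip// size_rot.
have n0 : (0 < ((size c)%:R : R)) by rewrite ltr0n; case: c c0 {uc ac}.
case: (\sum_(q <- _) _)%E => [r||] //.
  by rewrite -EFinM !lee_fin => hr; rewrite mulrC ler_pdivrMr.
by rewrite gt0_muleNy// ?leNye// lte_fin invr_gt0.
Unshelve. all: by end_near. Qed.

Definition clipped_neg (t : R) : R := Num.min 1 (Num.max 0 (- t)).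

Lemma clipped_neg_bounds t : 0 <= clipped_neg t <= 1.
Proof. by rewrite /clipped_neg le_min ler01 le_max lexx ge_min lexx. Qed.

Lemma clipped_neg_eq0 t : 0 <= t -> clipped_neg t = 0.
Proof.
by move=> t0; rewrite /clipped_neg max_l ?oppr_le0// min_r.
Qed.

Lemma continuous_clipped_neg : continuous clipped_neg.
Proof.
move=> t; apply: (@continuous_min R R (fun=> 1) (fun t => Num.max 0 (- t))).
  exact: cst_continuous.
apply: (@continuous_max R R (fun=> 0) (fun t => - t)); first exact: cst_continuous.
exact: (@continuousN R R^o R id t (@cvg_id _ _)).
Qed.

(** A bounded continuous function that vanishes as soon as one coordinate is nonnegative, yet is
    positive at negative constant vectors, where the limit law lives. *)
Definition test_function (x : 'rV[R]_d) : R := \prod_i clipped_neg (x 0 i).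

Lemma test_function_bounds (x : 'rV[R]_d) : 0 <= test_function x <= 1.
Proof.
apply/andP; split; last by apply: Num.Theory.prodr_ile1 => i _; exact: clipped_neg_bounds.
by apply: prodr_ge0 => i _; have /andP[] := clipped_neg_bounds (x 0 i).
Qed.

Lemma test_function_eq0 (x : 'rV[R]_d) i : 0 <= x 0 i -> test_function x = 0.
Proof. by move=> xi; rewrite /test_function (bigD1 i)//= clipped_neg_eq0// mul0r. Qed.

Lemma continuous_test_function : continuous test_function.
Proof.
have h (s : seq 'I_d) : continuous (fun x : 'rV[R]_d => \prod_(i <- s) clipped_neg (x 0 i)).
  elim: s => [|i s IH] x.
    by under eq_fun do rewrite big_nil; exact: cst_continuous.
  under eq_fun do rewrite big_cons.
  apply: (@cvgM R _ (nbhs x) _ (fun x : 'rV[R]_d => clipped_neg (x 0 i))); last exact: IH.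
  apply: (@continuous_comp _ _ _ (fun y : 'rV[R]_d => y 0 i) clipped_neg).
    exact: (@coord_continuous R 1 d 0 i).
  exact: continuous_clipped_neg.
exact: (h (index_enum 'I_d)).
Qed.

Lemma gauss_test_function_pos (s2 : R) : 0 < s2 ->
  (0 < gauss_diag_expect s2 test_function)%E.
Proof.
move=> s20; rewrite /gauss_diag_expect.
have sg0 : 0 < Num.sqrt s2 by rewrite sqrtr_gt0.
set sg := Num.sqrt s2 in sg0 *.
pose f (g : R) := test_function (const_mx (sg * g)) * std_gauss_pdf g.
have pi0 : 0 < Num.sqrt (2 * pi) :> R by rewrite sqrtr_gt0 mulr_gt0// pi_gt0.
have pdf0 g : 0 < std_gauss_pdf g :> R by rewrite /std_gauss_pdf divr_gt0// expR_gt0.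
have f0 g : 0 <= f g.
  by apply: mulr_ge0; [have /andP[] := test_function_bounds (const_mx (sg * g))|exact: ltW].
have mf : measurable_fun setT f.
  apply: measurable_funM.
    rewrite /test_function; under eq_fun do under eq_bigr do rewrite mxE.
    apply: measurable_prod => i _.
    apply: (measurableT_comp (continuous_measurable_fun continuous_clipped_neg)).
    exact: measurable_funM.
  apply: measurable_funM => //; apply: (measurableT_comp (@measurable_expR R)).
  by apply: measurable_funM => //; apply: measurable_funN => //; exact: measurable_funX.
(* A lower bound of the integrand on [-2, -1]: there each of the [d] factors is at least min(1, sg),
   and g^2 <= 4 bounds the density. *)
pose c : R := Num.min 1 sg ^+ d * (expR (- 2) / Num.sqrt (2 * pi)).
have c0 : 0 < c.
  by rewrite /c mulr_gt0// ?divr_gt0// ?expR_gt0// exprn_gt0// lt_min ltr01.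
pose I : set R := `[(- 2)%R, (- 1)%R]%classic.
have mI : measurable I by exact: measurable_itv.
have cf g : I g -> c <= f g.
  rewrite /I /= in_itv /= => /andP[g2 g1]; apply: ler_pM.
  - by rewrite exprn_ge0// le_min ler01 ltW.
  - by rewrite divr_ge0// ?expR_ge0// ltW.
  - rewrite /test_function -[X in _ ^+ X](card_ord d) -prodr_const.
    apply: ler_prod => i _; rewrite le_min ler01 (ltW sg0) /= mxE /clipped_neg.
    rewrite le_min !ge_min lexx /= !le_max; apply/orP; right; apply/orP; right.
    by have := mulr_ge0 (ltW sg0) (_ : 0 <= - 1 - g); rewrite subr_ge0 => /(_ g1); lra.
  - rewrite /std_gauss_pdf ler_pM2r ?invr_gt0// ler_expR.
    have h4 : g ^+ 2 <= 4 by nra.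
    lra.
have h1 : (\int[@lebesgue_measure R]_(g in I) (f g)%:E <=
    \int[@lebesgue_measure R]_g (f g)%:E)%E.
  apply: ge0_subset_integral => //; first exact/measurable_EFinP.
  by move=> g _; rewrite lee_fin.
apply: lt_le_trans h1.
have h2 : (\int[@lebesgue_measure R]_(g in I) (c%:E) <=
    \int[@lebesgue_measure R]_(g in I) (f g)%:E)%E.
  apply: ge0_le_integral => //.
  - by move=> g _; rewrite lee_fin ltW.
  - by apply/measurable_EFinP; exact: measurable_funTS.
apply: lt_le_trans h2.
have I1 : @lebesgue_measure R I = 1%:E.
  rewrite /I lebesgue_measure_itv /= lte_fin ifT; last lra.
  by rewrite -EFinB; congr EFin; lra.
by rewrite integral_cst// [X in (_ * X)%E]I1 mule1 lte_fin.
Qed.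

End Converse.

Theorem theorem2p8 (R : realType) (d : nat) (d0 : measure_display)
  (T : measurableType d0) (P : probability T R)
  (A : nat -> T -> 'M[\bar R]_d) (s2 : R) :
  (0 < d)%N ->
  iid_maxplus P A ->
  memory_loss P A ->
  (\int[P]_w ((\big[maxe/-oo]_i \big[maxe/-oo]_j A 1%N w i j) *
              (\big[maxe/-oo]_i \big[maxe/-oo]_j A 1%N w i j)) < +oo)%E ->
  (\int[P]_w ((\big[mine/+oo]_j \big[maxe/-oo]_i A 1%N w i j) *
              (\big[mine/+oo]_j \big[maxe/-oo]_i A 1%N w i j)) < +oo)%E ->
  (* Lyapunov exponent gamma = 0 *)
  {ae P, forall w, forall i : 'I_d,
     (fun n : nat => mp_orbit A (fun _ => 0) n w 0 i / n%:R) @ \oo --> (0 : R)} ->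
  0 <= s2 ->
  (forall X0 : T -> 'rV[R]_d, indep_init P A X0 -> clt_holds P A X0 s2) ->
  (s2 = 0 <->
   [set rho_max B | B in mp_semigroup (mp_support P A)] = [set 0%E]).
Proof.
move=> d_gt0 iidA ml _ colint lyap s2_ge0 clt.
have {}clt : clt_holds P A (fun=> 0) s2 by apply: clt; exact: indep_init_cst.
have supp := ae_support iidA.
split=> [s20|rho0].
  rewrite s20 in clt.
  have i0 : 'I_d := Ordinal d_gt0.
  have [N [K [N0 r1]]] := memory_loss_rank1_bounded iidA ml (ae_columns iidA colint).
  have Qp := path_law_cylinder iidA.
  pose law1 V := fine (P (mx_event (A 1%N) V)).
  have rho0 B : mp_semigroup (mp_support P A) B -> rho_max B = 0%E.
    move=> /(semigroup_approximable iidA)[m m0 aB].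
    have c0 := clt_degenerate_cos iidA i0 clt.
    have ly := lyapunov_small iidA lyap.
    apply/eqP; rewrite eq_le; apply/andP; split.
      exact: (approximable_rho_le0 (p := law1) Qp N0 c0 r1 ly m0 aB).
    exact: (approximable_rho_ge0 (p := law1) Qp N0 c0 r1 ly m0 aB).
  apply/seteqP; split=> [_ [B hB <-]|_ ->]; first exact: rho0.
  (* The value 0 must also be attained, so T_A must be nonempty: almost every realization of A(1)
     belongs to it. *)
  have [w hw] := ae_exists supp.
  have hB := mp_sg_base (hw 0%N).
  by exists (A 1%N w); [exact: hB|exact: rho0].
have {}rho0 B : mp_semigroup (mp_support P A) B -> rho_max B = 0%E.
  by move=> hB; have : [set 0%E] (rho_max B) by rewrite -rho0; exists B.
(* A positive variance would give [test_function] a positive limit expectation, whereas its mean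
   along the orbit vanishes at every positive time. *)
apply/eqP; rewrite eq_le s2_ge0 andbT leNgt; apply/negP => /(gauss_test_function_pos d).
have bf : exists M : R, forall x : 'rV[R]_d, `|test_function x| <= M.
  by exists 1 => x; have /andP[f0 f1] := test_function_bounds x; rewrite ger0_norm.
have := clt _ (@continuous_test_function R d) bf.
pose y n w : 'rV[R]_d := (Num.sqrt n%:R)^-1 *: mp_orbit A (fun=> 0) n w.
have E n : (\int[P]_w (test_function (y n.+1 w))%:E = 0)%E.
  rewrite -[RHS](integral0 P setT); apply: ge0_ae_eq_integral => //.
  - apply/measurable_EFinP; rewrite /test_function /y; apply: measurable_prod => i _.
    apply: (measurableT_comp (continuous_measurable_fun (@continuous_clipped_neg R))).
    under eq_fun do rewrite mxE (mp_orbit_path iidA).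
    apply: measurable_funM => //.
    exact: (measurableT_comp (@measurable_out R d n.+1 0 i) (measurable_path iidA)).
  - by move=> w _; rewrite lee_fin; have /andP[] := test_function_bounds (y n.+1 w).
  - apply: negligibleS supp => w /= h hw; apply: h => _.
    have rw := rho0 _ (prodseq_semigroup iidA n hw).
    have opw := prodseq_op (traj iidA w) n.+1.
    have [i hi] : exists i, 0 <= mp_apply (prodseq (traj iidA w) n.+1) 0 0 i.
      apply: contrapT => /forallNP no.
      have : (rho_max (prodseq (traj iidA w) n.+1) < 0)%E.
        by apply: (rho_max_lt0 opw) => i; rewrite ltNge; apply/negP; exact: no.
      by rewrite rw ltxx.
    congr EFin; apply: (@test_function_eq0 _ _ _ i).
    have e := mp_orbit_path iidA (fun=> 0) n.+1 w.
    rewrite mxE; apply: mulr_ge0; first by rewrite invr_ge0 sqrtr_ge0.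
    exact: (eq_ind_r (fun v : 'rV[R]_d => 0 <= v 0 i) hi e).
move=> cv.
have cv0 : (fun n => (\int[P]_w (test_function (y n w))%:E)%E) @ \oo --> (0 : \bar R)%E.
  apply: cvg_near_cst; exists 1%N => // -[|n] //= _; exact: E.
have := @cvg_unique (\bar R) (@ereal_hausdorff R) _ _ _ _ cv cv0.
by move=> ->; rewrite ltxx.
Qed.
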